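(* Let $n\ge2$ and let $\psi\colon\mathbb H^n\to\mathbb R$ be a positive smooth function such that $\log\psi$ is a Kähler potential of $\omega_{\mathbb H^n}$. Suppose $\|\partial\log\psi\|_{\omega_{\mathbb H^n}}^2\equiv c$ for some constant $c\in\mathbb R$. Then $c=n+1$.
   Context: $\mathbb H^n=\{w=(w',w_n)\in\mathbb C^{n-1}\times\mathbb C:\operatorname{Re}w_n>|w'|^2\}$ and $\omega_{\mathbb H^n}=-(n+1)\sqrt{-1}\,\partial\bar\partial\log(\operatorname{Re}w_n-|w'|^2)$ (the Bergman metric, Kähler--Einstein with Ricci curvature $-1$). A real function $\eta$ is a Kähler potential of $\omega_{\mathbb H^n}$ if $\sqrt{-1}\,\partial\bar\partial\eta=\omega_{\mathbb H^n}$. If $\omega=\sqrt{-1}\sum g_{i\bar j}\,dw_i\wedge d\bar w_j$, and $\sum_j g_{i\bar j}g^{k\bar j}=\delta_{ik}$, then $\|\partial\eta\|_\omega^2=\sum_{k,j}g^{k\bar j}\frac{\partial\eta}{\partial w_k}\frac{\partial\eta}{\partial\bar w_j}$. *)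

(* Defs.v *)
From HB Require Import structures.
From mathcomp Require Import all_boot all_order all_algebra.
From mathcomp Require Import complex.
From mathcomp Require Import all_classical all_reals all_analysis.

Set Implicit Arguments.
Unset Strict Implicit.
Unset Printing Implicit Defensive.

Import Order.TTheory GRing.Theory Num.Theory.
Import numFieldNormedType.Exports.

Local Open Scope classical_set_scope.
Local Open Scope ring_scope.
Local Open Scope complex_scope.

(* C^n with its underlying real normed space R^n x R^n: the pair (x, y) is the
   point w with coordinates w_k = x_k + i y_k.  MathComp-Analysis puts no real
   normed module structure on R[i], so real derivatives are taken on the pair. *)
Definition Cvec (R : realType) (n : nat) := ('rV[R]_n * 'rV[R]_n)%type.

Definition coord (R : realType) (n : nat) (w : Cvec R n) (k : 'I_n) : R[i] :=
  w.1 0 k +i* w.2 0 k.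

(* The directions of the real coordinates x_k and y_k. *)
Definition ex (R : realType) (n : nat) (k : 'I_n) : Cvec R n :=
  (delta_mx 0 k, 0).
Definition ey (R : realType) (n : nat) (k : 'I_n) : Cvec R n :=
  (0, delta_mx 0 k).

Definition iter_derive (R : realType) (n : nat) (f : Cvec R n -> R)
    (vs : seq (Cvec R n)) : Cvec R n -> R :=
  foldl (fun (g : Cvec R n -> R) (v : Cvec R n) => fun w => 'D_v g w) f vs.

(* C^oo on an open set U, as infinite Frechet differentiability over R: f and
   all its iterated directional derivatives are differentiable on U.  The
   values of f outside U play no role. *)
Definition smooth_on (R : realType) (n : nat) (U : set (Cvec R n))
    (f : Cvec R n -> R) : Prop :=
  forall (vs : seq (Cvec R n)) (w : Cvec R n),
    U w -> differentiable (iter_derive f vs) w.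

(* Real directional derivative of a complex-valued function. *)
Definition cderive (R : realType) (n : nat) (v : Cvec R n)
    (F : Cvec R n -> R[i]) (w : Cvec R n) : R[i] :=
  ('D_v (fun z => complex.Re (F z)) w) +i* ('D_v (fun z => complex.Im (F z)) w).

(* Wirtinger operators d/dw_k and d/d(conjugate w_k). *)
Definition dw (R : realType) (n : nat) (k : 'I_n)
    (F : Cvec R n -> R[i]) (w : Cvec R n) : R[i] :=
  2%:R^-1 * (cderive (ex R k) F w - (0 +i* 1) * cderive (ey R k) F w).
Definition dwbar (R : realType) (n : nat) (k : 'I_n)
    (F : Cvec R n -> R[i]) (w : Cvec R n) : R[i] :=
  2%:R^-1 * (cderive (ex R k) F w + (0 +i* 1) * cderive (ey R k) F w).

(* A (1,1)-form sqrt(-1) * sum a_ij dw_i /\ d(conjugate w_j) is represented by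
   its coefficient matrix (a_ij). *)
Definition form11 (R : realType) (n : nat) := Cvec R n -> 'M[R[i]]_n.

(* sqrt(-1) * d dbar f *)
Definition ddbar (R : realType) (n : nat) (f : Cvec R n -> R) : form11 R n :=
  fun w => \matrix_(i, j) dw i (dwbar j (fun z => (f z)%:C)) w.

Definition kahler_potential_on (R : realType) (n : nat) (U : set (Cvec R n))
    (omega : form11 R n) (eta : Cvec R n -> R) : Prop :=
  forall w, U w -> ddbar eta w = omega w.

(* The g^{k jbar} of the convention sum_j g_{i jbar} g^{k jbar} = delta_ik,
   hence the transpose. *)
Definition inv_metric (R : realType) (n : nat) (g : 'M[R[i]]_n) : 'M[R[i]]_n :=
  (invmx g)^T.

Definition sqnorm_d (R : realType) (n : nat) (omega : form11 R n)
    (eta : Cvec R n -> R) (w : Cvec R n) : R[i] :=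
  \sum_k \sum_j inv_metric (omega w) k j
    * dw k (fun z => (eta z)%:C) w * dwbar j (fun z => (eta z)%:C) w.

Definition modulus_sq (R : realType) (z : R[i]) : R :=
  complex.Re z ^+ 2 + complex.Im z ^+ 2.

(* In complex dimension n.+1 the coordinate w_n of the text is the one indexed
   by ord_max, and w' consists of the other n ones. *)
Definition siegel_defect (R : realType) (n : nat) (w : Cvec R n.+1) : R :=
  complex.Re (coord w ord_max)
  - \sum_(k < n) modulus_sq (coord w (widen_ord (leqnSn n) k)).

Definition siegel (R : realType) (n : nat) : set (Cvec R n.+1) :=
  [set w | \sum_(k < n) modulus_sq (coord w (widen_ord (leqnSn n) k))
           < complex.Re (coord w ord_max)].

(* The factor (dimension + 1) is n.+2 in complex dimension n.+1. *)
Definition omega_siegel (R : realType) (n : nat) : form11 R n.+1 :=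
  fun w => - (n.+2)%:R *: ddbar (fun z => ln (siegel_defect z)) w.

Arguments siegel R n : clear implicits.
Arguments omega_siegel R n : clear implicits.

(* Main.v *)
From HB Require Import structures.
Require Import Defs.
From mathcomp Require Import all_boot all_order all_algebra.
From mathcomp Require Import complex.
From mathcomp Require Import all_classical all_reals all_analysis.
From mathcomp Require Import ring.

(* Write eta = log psi, D = Re w_n - |w'|^2 and N = n + 1, n being the complex
   dimension.  Then u = eta + N log D is pluriharmonic, so the h_l = du/dw_l are
   holomorphic and dh_l/dw_j is symmetric.  Inverting the metric explicitly turns
   ||d eta||^2 = c into
     D (sum_k |h_k + 2 conj(w_k) h_n|^2 + 4 D |h_n|^2 - 2 N (h_n + conj h_n)) = K
   with K = N (c - N).  At the single point p = (0, 1), the vanishing of the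
   first derivatives of the left-hand side says that the gradient v of eta is an
   eigenvector of the Hessian of u up to explicit terms; inserting this in the
   vanishing of its second derivative along v and conj v leaves
   K (K + N^2) = 0, that is c (c - N) = 0.  If K = - N^2, the second derivative
   along d/dw_n and its conjugate is a sum of squares plus N^2 / 4, so it does
   not vanish.  The second-order calculations are done with the jets
   (F, dF, dbar F, dbar d F) at p, which multiply by the Leibniz rule. *)

Import Order.TTheory GRing.Theory Num.Theory.
Import numFieldNormedType.Exports.

Local Open Scope classical_set_scope.
Local Open Scope ring_scope.
Local Open Scope complex_scope.

Set Implicit Arguments.
Unset Strict Implicit.
Unset Printing Implicit Defensive.

(* mathcomp.algebra.vector shadows this name. *)
Local Notation coord := Defs.coord.

(** * Locality of differentiability and restriction to lines *)

Lemma near_eq_differentiable (R : realType) (V : normedModType R)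
    (f g : V -> R) (w : V) :
  (\near w, f w = g w) -> differentiable f w -> differentiable g w.
Proof.
move=> fg df.
(* The difference [g - f] vanishes near [w], so it is differentiable there with differential 0. *)
have -> : g = f + (g - f) by rewrite addrC subrK.
apply: differentiableD => //.
move: fg => /nbhs_ballP[r /= r0 Hr].
have hsh : (g - f) \o shift w =
    cst ((g - f) w) + (\0 : {linear V -> R}) +o_ 0 id.
  apply: eqaddoE; apply/eqaddoP => e e0; apply/nbhs_ballP; exists r => //= z.
  rewrite -ball_normE /= sub0r normrN => zr; rewrite !fctE /= addr0.
  rewrite -(Hr (z + w)); last by rewrite -ball_normE /= opprD addrCA subrr addr0 normrN.
  rewrite -(Hr w); last exact: ballxx.
  by rewrite !subrr normr0 mulr_ge0// ltW.
apply/diff_locallyP; split.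
  rewrite (diff_unique _ hsh); first exact: cst_continuous.
  exact: cst_continuous.
by rewrite (diff_unique _ hsh)//; exact: cst_continuous.
Qed.

(** The two difference quotients coincide term by term. This form feeds directional derivatives to
    the one-variable mean value theorem. *)
Lemma is_derive_line (R : realType) (V : normedModType R) (f : V -> R)
    (q u : V) (s : R) :
  differentiable f (s *: u + q) ->
  is_derive s 1 (fun t : R => f (t *: u + q)) ('D_u f (s *: u + q)).
Proof.
move=> df; have := @diff_derivable _ _ _ f _ u df.
have E : (fun h : R => h^-1 *: (((fun t : R => f (t *: u + q)) \o shift s)
          (h *: 1) - f (s *: u + q))) =
  (fun h : R => h^-1 *: ((f \o shift (s *: u + q)) (h *: u) - f (s *: u + q))).
  apply/funext => h /=; rewrite [h *: 1]mulr1 addrA -scalerDl.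
  by [].
move=> D; split; first by rewrite /derivable E.
by rewrite /derive E.
Qed.

(** * Symmetry of second derivatives *)

Section Schwarz.
Variables (R : realType) (V : normedModType R) (f : V -> R) (w : V).
Hypothesis df : \forall z \near w, differentiable f z.

(** The mean value theorem in the direction [u] turns the second difference into [t] times an
    increment of ['D_u f] along [t *: v]. The first-order expansion of ['D_u f] at [w] then gives
    the main term, so differentiability of ['D_u f] at the single point [w] suffices. *)
Lemma second_difference (u v : V) (e : R) :
  differentiable (fun z => 'D_u f z) w -> 0 < e ->
  \forall t \near 0^'+,
   `|f (t *: u + (t *: v + w)) - f (t *: u + w) - (f (t *: v + w) - f w)
     - t ^+ 2 * 'D_v (fun z => 'D_u f z) w| <= e * t ^+ 2.
Proof.
move=> dg e0; set g := fun z => _ in dg *.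
(* Points [a *: u + b *: v] with [a], [b] in [0, t] have norm at most [t * M]; the summand 1 keeps
   [M] positive when [u] and [v] vanish. The expansion is used at two such points and multiplied by
   [t], hence the tolerance [e / (2 * M)]. *)
pose M := `|u| + `|v| + 1.
have M0 : 0 < M by rewrite ltr_wpDl// addr_ge0.
have e'0 : 0 < e / (2 * M) by rewrite divr_gt0// mulr_gt0.
have : \forall k \near (0 : V), `|g (k + w) - g w - 'd g w k| <= e / (2 * M) * `|k|.
  have /diff_locally/eqaddoP/(_ _ e'0) := dg.
  by apply: filterS => k /=; rewrite !fctE opprD addrA.
move=> /nbhs_ballP[r /= r0 Hr].
move: df => /nbhs_ballP[r' /= r'0 Hr'].
near=> t.
have t0 : 0 < t by [].
have tM : t * M < r by rewrite -ltr_pdivlMr//; near: t; apply: nbhs_right_lt; rewrite divr_gt0.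
have tM' : t * M < r' by rewrite -ltr_pdivlMr//; near: t; apply: nbhs_right_lt; rewrite divr_gt0.
have bd (a b : R) : 0 <= a <= t -> 0 <= b <= t -> `|a *: u + b *: v| <= t * M.
  move=> /andP[a0 at_] /andP[b0 bt].
  rewrite (le_trans (ler_normD _ _))// !normrZ !ger0_norm// /M !mulrDr mulr1.
  rewrite -[leLHS]addr0; apply: lerD; last exact: ltW.
  by apply: lerD; apply: ler_wpM2r.
have dfp (a b : R) : 0 <= a <= t -> 0 <= b <= t -> differentiable f (a *: u + (b *: v + w)).
  move=> ha hb; apply: Hr'; rewrite -ball_normE /= addrA opprD addrA addrAC subrr sub0r normrN.
  exact: le_lt_trans (bd _ _ ha hb) tM'.
have gp (a b : R) : 0 <= a <= t -> 0 <= b <= t ->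
    `|g (a *: u + (b *: v + w)) - g w - (a * 'd g w u + b * 'd g w v)|
    <= e / (2 * M) * (t * M).
  move=> ha hb.
  have := Hr (a *: u + b *: v); rewrite -ball_normE /= sub0r normrN.
  move=> /(_ (le_lt_trans (bd _ _ ha hb) tM)); rewrite addrA linearD !linearZ /=.
  by move=> /le_trans; apply; rewrite ler_pM2l ?bd.
pose phi s := f (s *: u + (t *: v + w)) - f (s *: u + w).
have t00 : 0 <= t <= t by apply/andP; split => //; exact: ltW.
have z00 : 0 <= (0 : R) <= t by apply/andP; split => //; exact: ltW.
have dphi s : 0 <= s <= t ->
   is_derive s 1 phi (g (s *: u + (t *: v + w)) - g (s *: u + w)).
  move=> hs; apply: is_deriveB.
    by apply: is_derive_line; exact: dfp.
  apply: is_derive_line; have := dfp s 0 hs z00; by rewrite scale0r add0r.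
have [||x] := @MVT R phi (fun s => g (s *: u + (t *: v + w)) - g (s *: u + w)) 0 t t0.
- move=> x; rewrite in_itv /= => /andP[x0 xt]; apply: dphi; by rewrite !ltW.
- apply: derivable_within_continuous => x; rewrite in_itv /= => hx.
  by have [] := dphi _ hx.
rewrite in_itv /= => /andP[x0 xt] mvt.
have hx : 0 <= x <= t by rewrite !ltW.
have := gp x t hx t00; have := gp x 0 hx z00.
rewrite scale0r add0r mul0r addr0 => h1 h2.
move: mvt; rewrite /phi scale0r !add0r subr0 => ->.
rewrite (deriveE _ dg).
have -> : e * t ^+ 2 = (e / (2 * M) * (t * M) + e / (2 * M) * (t * M)) * t.
  by field; rewrite gt_eqF.
set a := g _ in h2 *; set b := g (x *: u + w) in h1 *.
have -> : (a - b) * t - t ^+ 2 * 'd g w v =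
  ((a - g w - (x * 'd g w u + t * 'd g w v)) - (b - g w - x * 'd g w u)) * t by ring.
rewrite normrM (gtr0_norm t0) ler_pM2r//.
by rewrite (le_trans (ler_normB _ _))// lerD.
Unshelve. all: by end_near. Qed.

(** The second difference is symmetric in [u] and [v], so both mixed derivatives times [t ^+ 2]
    approximate the same number within an arbitrarily small multiple of [t ^+ 2]. *)
Lemma derive_comm (u v : V) :
  differentiable (fun z => 'D_u f z) w -> differentiable (fun z => 'D_v f z) w ->
  'D_v (fun z => 'D_u f z) w = 'D_u (fun z => 'D_v f z) w.
Proof.
move=> du dv; apply/eqP; rewrite -subr_eq0 -normr_le0.
apply/ler_addgt0Pl => e e0; rewrite addr0.
have e20 : 0 < e / 2 by rewrite divr_gt0.
have [t [[h1 h2] t0]] := filter_ex (filterI (filterI (second_difference v du e20)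
  (second_difference u dv e20)) (nbhs_right_gt 0)).
rewrite -(@ler_pM2r _ (t ^+ 2)) ?exprn_gt0// -{1}(gtr0_norm (exprn_gt0 2 t0)) -normrM.
move: h1 h2; rewrite [t *: v + (t *: u + w)]addrCA.
set a := f _; set b := f _; set c := f _; set d := f w.
set X := 'D_v _ _; set Y := 'D_u _ _ => h1 h2.
have -> : (X - Y) * t ^+ 2 = (a - c - (b - d) - t ^+ 2 * Y) - (a - b - (c - d) - t ^+ 2 * X) by ring.
rewrite (le_trans (ler_normB _ _))//.
have -> : e * t ^+ 2 = e / 2 * t ^+ 2 + e / 2 * t ^+ 2 by field.
exact: lerD h2 h1.
Qed.

End Schwarz.

(** * Finite-order differentiability on an open set *)

Section Regularity.
Variables (R : realType) (V : normedModType R) (U : set V).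
Hypothesis oU : open U.

(** This is k-fold Frechet differentiability on [U], with no continuity asked of the top derivatives
    and no condition at all for k = 0. A finite order makes the closure properties provable by
    induction. *)
Fixpoint Ck (k : nat) (f : V -> R) : Prop :=
  if k is k'.+1 then
    (forall w, U w -> differentiable f w) /\
    (forall v, Ck k' (fun w => 'D_v f w))
  else True.

Lemma near_open (P : V -> Prop) (w : V) :
  U w -> (forall z, U z -> P z) -> \forall z \near w, P z.
Proof. by move=> Uw UP; near=> z; apply: UP; near: z; exact: open_nbhs_nbhs.
Unshelve. all: by end_near. Qed.

Lemma derive_eq_on (f g : V -> R) (v w : V) :
  (forall z, U z -> f z = g z) -> U w -> 'D_v f w = 'D_v g w.
Proof. by move=> fg Uw; apply: near_eq_derive; exact: near_open. Qed.

Lemma Ck_eq k (f g : V -> R) :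
  (forall z, U z -> f z = g z) -> Ck k f -> Ck k g.
Proof.
elim: k f g => [//|k IH] f g fg [df Df]; split=> [w Uw|v].
  by apply: (@near_eq_differentiable _ _ f); [exact: near_open|exact: df].
by apply: IH (Df v) => z Uz; exact: derive_eq_on.
Qed.

Lemma CkS k f : Ck k.+1 f -> Ck k f.
Proof. by elim: k f => [//|k IH] f [df Df]; split=> // v; exact: IH. Qed.

Lemma Ck_cst k c : Ck k (fun=> c).
Proof.
elim: k c => [//|k IH] c; split=> [w _|v]; first exact: differentiable_cst.
by under eq_fun do rewrite (derive_cst c); exact: IH.
Qed.

Lemma Ck_linear k (f : {linear V -> R}) : continuous f -> Ck k f.
Proof.
move=> cf; case: k => [//|k]; split=> [w _|v].
  exact: linear_differentiable.
apply: (@Ck_eq k (fun=> f v)); last exact: Ck_cst.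
by move=> z _; rewrite deriveE ?diff_lin//; exact: linear_differentiable.
Qed.

Lemma CkD k f g : Ck k f -> Ck k g -> Ck k (fun w => f w + g w).
Proof.
elim: k f g => [//|k IH] f g [df Df] [dg Dg]; split=> [w Uw|v].
  by apply: (@differentiableD _ _ _ f g); [exact: df|exact: dg].
apply: Ck_eq (IH _ _ (Df v) (Dg v)) => z Uz.
rewrite (@deriveD _ _ _ f g)//; apply: diff_derivable; [exact: df|exact: dg].
Qed.

Lemma CkM k f g : Ck k f -> Ck k g -> Ck k (fun w => f w * g w).
Proof.
elim: k f g => [//|k IH] f g Cf Cg; have [df Df] := Cf; have [dg Dg] := Cg.
split=> [w Uw|v].
  by apply: (@differentiableM _ _ f g); [exact: df|exact: dg].
apply: Ck_eq (CkD (IH _ _ (CkS Cf) (Dg v)) (IH _ _ (CkS Cg) (Df v))) => z Uz.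
rewrite (@deriveM _ _ f g)//; apply: diff_derivable; [exact: df|exact: dg].
Qed.

Lemma CkV k f : (forall w, U w -> f w != 0) -> Ck k f -> Ck k (fun w => (f w)^-1).
Proof.
move=> f0; elim: k => [//|k IH] Cf; have [df Df] := Cf; have Cf' := IH (CkS Cf).
split=> [w Uw|v].
  by apply: (@differentiableV _ _ f); [exact: df|exact: f0].
(* The derivative of 1/f is -(1/f)(1/f) ['D_v f], where the induction hypothesis covers 1/f at order
   [k]. *)
apply: Ck_eq (CkM (CkM (Ck_cst k (-1)) (CkM Cf' Cf')) (Df v)) => z Uz.
rewrite (@deriveV _ _ f); [|exact: f0|by apply: diff_derivable; exact: df].
by rewrite expr2 invfM mulN1r.
Qed.

Lemma derive_ln (f : V -> R) (w v : V) : 0 < f w -> differentiable f w ->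
  differentiable (fun z => ln (f z)) w /\
  'D_v (fun z => ln (f z)) w = (f w)^-1 * 'D_v f w.
Proof.
move=> f0 df; have [/derivable1_diffP dl vl] := is_derive1_ln f0.
have dc : differentiable (@ln R \o f) w by exact: differentiable_comp.
split=> //; rewrite (deriveE _ dc) (deriveE _ df) diff_comp//=.
rewrite -[X in 'd (@ln R) _ X]mulr1 [LHS]linearZ /= -(deriveE (1 : R^o) dl) vl.
by rewrite mulrC.
Qed.

(** No induction is required: one differentiation removes the logarithm and leaves a product covered
    by [CkV] and [CkM]. *)
Lemma Ck_ln k f : (forall w, U w -> 0 < f w) -> Ck k f -> Ck k (fun w => ln (f w)).
Proof.
move=> f0; case: k => [//|k] Cf; have [df Df] := Cf; split=> [w Uw|v].
  by have [] := derive_ln 0 (f0 w Uw) (df w Uw).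
have f1 w : U w -> f w != 0 by move=> Uw; rewrite gt_eqF ?f0.
apply: Ck_eq (CkM (CkV f1 (CkS Cf)) (Df v)) => z Uz.
by have [_ ->] := derive_ln v (f0 z Uz) (df z Uz).
Qed.

Lemma Ck_derive_comm (f : V -> R) (u v w : V) : Ck 2 f -> U w ->
  'D_v (fun z => 'D_u f z) w = 'D_u (fun z => 'D_v f z) w.
Proof.
move=> [df Df] Uw; apply: derive_comm; first exact: near_open.
  by have [D _] := Df u; exact: D.
by have [D _] := Df v; exact: D.
Qed.

End Regularity.

Lemma smooth_on_Ck (R : realType) (n : nat) (U : set (Cvec R n)) f k :
  smooth_on U f -> Ck U k f.
Proof.
elim: k f => [//|k IH] f sf; split=> [w Uw|v]; first exact: (sf [::]).
by apply: IH => vs w Uw; exact: (sf (v :: vs)).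
Qed.

Lemma derive_mulD (R : realType) (V : normedModType R) (f g h k : V -> R) (v w : V) :
  derivable f w v -> derivable g w v -> derivable h w v -> derivable k w v ->
  'D_v (f * g + h * k) w =
  f w * 'D_v g w + g w * 'D_v f w + (h w * 'D_v k w + k w * 'D_v h w).
Proof.
move=> df dg dh dk; rewrite (deriveD (derivableM df dg) (derivableM dh dk)).
by rewrite (deriveM df dg) (deriveM dh dk).
Qed.

Lemma derive_mulB (R : realType) (V : normedModType R) (f g h k : V -> R) (v w : V) :
  derivable f w v -> derivable g w v -> derivable h w v -> derivable k w v ->
  'D_v (f * g - h * k) w =
  f w * 'D_v g w + g w * 'D_v f w - (h w * 'D_v k w + k w * 'D_v h w).
Proof.
move=> df dg dh dk; rewrite (deriveB (derivableM df dg) (derivableM dh dk)).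
by rewrite (deriveM df dg) (deriveM dh dk).
Qed.

(** * Complex directional derivatives *)

Section ComplexCalculus.
Variables (R : realType) (m : nat) (U : set (Cvec R m)).
Hypothesis oU : open U.
Local Notation C := R[i].
Implicit Types (F G : Cvec R m -> C) (v w : Cvec R m).

Definition CCk k F :=
  Ck U k (fun w => complex.Re (F w)) /\ Ck U k (fun w => complex.Im (F w)).

Lemma CCk_eq k F G : (forall w, U w -> F w = G w) -> CCk k F -> CCk k G.
Proof.
by move=> FG [rF iF]; split; [apply: (Ck_eq oU _ rF)|apply: (Ck_eq oU _ iF)] => w Uw; rewrite FG.
Qed.

Lemma CCkS k F : CCk k.+1 F -> CCk k F.
Proof. by move=> [rF iF]; split; exact: CkS. Qed.

Lemma CCk_cst k c : CCk k (fun=> c).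
Proof. by split; exact: Ck_cst. Qed.

Lemma CCk_real k (f : Cvec R m -> R) : Ck U k f -> CCk k (fun w => (f w)%:C).
Proof. by move=> Cf; split=> //=; exact: Ck_cst. Qed.

Lemma CCk_conj k F : CCk k F -> CCk k (fun w => (F w)^*%C).
Proof.
move=> [rF iF]; split.
  by apply: (Ck_eq oU _ rF) => w _; case: (F w).
apply: (Ck_eq oU _ (CkM oU (Ck_cst U k (-1)) iF)) => // w _.
by case: (F w) => a b /=; rewrite mulN1r.
Qed.

Lemma CCkD k F G : CCk k F -> CCk k G -> CCk k (fun w => F w + G w).
Proof.
move=> [rF iF] [rG iG]; split.
  by apply: (Ck_eq oU _ (CkD oU rF rG)) => // w _; case: (F w) (G w) => [a b] [c d].
by apply: (Ck_eq oU _ (CkD oU iF iG)) => // w _; case: (F w) (G w) => [a b] [c d].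
Qed.

Lemma CCkM k F G : CCk k F -> CCk k G -> CCk k (fun w => F w * G w).
Proof.
move=> [rF iF] [rG iG]; split.
  apply: (Ck_eq oU _ (CkD oU (CkM oU rF rG) (CkM oU (Ck_cst U k (-1)) (CkM oU iF iG)))) => // w _.
  by case: (F w) (G w) => [a b] [c d] /=; rewrite mulN1r.
by apply: (Ck_eq oU _ (CkD oU (CkM oU rF iG) (CkM oU iF rG))) => // w _; case: (F w) (G w) => [a b] [c d].
Qed.

Lemma CCk_sum k (I : Type) (r : seq I) (F : I -> Cvec R m -> C) :
  (forall i, CCk k (F i)) -> CCk k (fun w => \sum_(i <- r) F i w).
Proof.
move=> CF; elim: r => [|i r IH].
  by apply: CCk_eq (CCk_cst k 0) => w _; rewrite big_nil.
by apply: CCk_eq (CCkD (CF i) IH) => w _; rewrite big_cons.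
Qed.

Lemma CCk_cderive k F v : CCk k.+1 F -> CCk k (cderive v F).
Proof. by move=> [[_ rF] [_ iF]]; split; [exact: rF|exact: iF]. Qed.

Lemma cderive_eq F G v w : (forall z, U z -> F z = G z) -> U w ->
  cderive v F w = cderive v G w.
Proof.
move=> FG Uw; rewrite /cderive; congr (_ +i* _);
  by apply: (derive_eq_on oU) => // z Uz; rewrite FG.
Qed.

Lemma cderive_cst c v w : cderive v (fun=> c) w = 0.
Proof. by rewrite /cderive !derive_cst. Qed.

Lemma cderiveD F G v w : CCk 1 F -> CCk 1 G -> U w ->
  cderive v (fun z => F z + G z) w = cderive v F w + cderive v G w.
Proof.
move=> [[rF _] [iF _]] [[rG _] [iG _]] Uw.
have d f : (forall w, U w -> differentiable (f : _ -> R) w) -> derivable f w v.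
  by move=> df; apply: diff_derivable; exact: df.
have e1 : (fun z => complex.Re (F z + G z)) =
  ((fun z => complex.Re (F z)) + (fun z => complex.Re (G z))).
  by apply/funext => z; rewrite fctE; case: (F z) (G z) => [a b] [c e].
have e2 : (fun z => complex.Im (F z + G z)) =
  ((fun z => complex.Im (F z)) + (fun z => complex.Im (G z))).
  by apply/funext => z; rewrite fctE; case: (F z) (G z) => [a b] [c e].
by rewrite /cderive e1 e2 (deriveD (d _ rF) (d _ rG)) (deriveD (d _ iF) (d _ iG)).
Qed.

Lemma cderiveM F G v w : CCk 1 F -> CCk 1 G -> U w ->
  cderive v (fun z => F z * G z) w = cderive v F w * G w + F w * cderive v G w.
Proof.
move=> [[rF _] [iF _]] [[rG _] [iG _]] Uw.
have d f : (forall w, U w -> differentiable (f : _ -> R) w) -> derivable f w v.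
  by move=> df; apply: diff_derivable; exact: df.
have e1 : (fun z => complex.Re (F z * G z)) =
  ((fun z => complex.Re (F z)) * (fun z => complex.Re (G z))) -
  ((fun z => complex.Im (F z)) * (fun z => complex.Im (G z))).
  by apply/funext => z; rewrite !fctE; case: (F z) (G z) => [a b] [c e].
have e2 : (fun z => complex.Im (F z * G z)) =
  ((fun z => complex.Re (F z)) * (fun z => complex.Im (G z))) +
  ((fun z => complex.Im (F z)) * (fun z => complex.Re (G z))).
  by apply/funext => z; rewrite !fctE; case: (F z) (G z) => [a b] [c e].
rewrite /cderive e1 e2 (derive_mulB (d _ rF) (d _ rG) (d _ iF) (d _ iG)).
rewrite (derive_mulD (d _ rF) (d _ iG) (d _ iF) (d _ rG)).
case: (F w) (G w) => [a b] [c e].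
by apply/eqP; rewrite eq_complex /=; apply/andP; split; apply/eqP; ring.
Qed.

Lemma cderive_conj F v w : CCk 1 F -> U w ->
  cderive v (fun z => (F z)^*%C) w = (cderive v F w)^*%C.
Proof.
move=> [[rF _] [iF _]] Uw; rewrite /cderive /=; congr (_ +i* _).
  by apply: (derive_eq_on oU) => // z _; case: (F z).
have -> : (fun z => complex.Im (F z)^*%C) = - (fun z => complex.Im (F z)).
  by apply/funext => z; rewrite fctE; case: (F z).
by rewrite deriveN//; apply: diff_derivable; exact: iF.
Qed.

Lemma cderive_comm F u v w : CCk 2 F -> U w ->
  cderive v (cderive u F) w = cderive u (cderive v F) w.
Proof.
move=> [rF iF] Uw.
exact: (congr2 (@Complex R) (Ck_derive_comm oU u v rF Uw) (Ck_derive_comm oU u v iF Uw)).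
Qed.

(* A function of type bool * 'I_m -> C is a complexified tangent vector, given by
   its components in the frame dir. *)
Definition dir (i : bool * 'I_m) : Cvec R m := if i.1 then ey R i.2 else ex R i.2.

Definition vderive (z : bool * 'I_m -> C) F w : C := \sum_i z i * cderive (dir i) F w.

Implicit Types (y z : bool * 'I_m -> C).

Lemma CCk_vderive k z F : CCk k.+1 F -> CCk k (vderive z F).
Proof.
by move=> CF; apply: CCk_sum => i; apply: CCkM; [exact: CCk_cst|exact: CCk_cderive].
Qed.

Lemma vderive_eq z F G w : (forall x, U x -> F x = G x) -> U w -> vderive z F w = vderive z G w.
Proof. by move=> FG Uw; apply: eq_bigr => i _; rewrite (cderive_eq _ FG). Qed.

Lemma vderive_cst z c w : vderive z (fun=> c) w = 0.
Proof. by rewrite /vderive big1// => i _; rewrite cderive_cst mulr0. Qed.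

Lemma vderiveD z F G w : CCk 1 F -> CCk 1 G -> U w ->
  vderive z (fun x => F x + G x) w = vderive z F w + vderive z G w.
Proof.
move=> CF CG Uw; rewrite -big_split; apply: eq_bigr => i _.
by rewrite cderiveD// mulrDr.
Qed.

Lemma vderiveM z F G w : CCk 1 F -> CCk 1 G -> U w ->
  vderive z (fun x => F x * G x) w = vderive z F w * G w + F w * vderive z G w.
Proof.
move=> CF CG Uw; rewrite mulr_suml mulr_sumr -big_split; apply: eq_bigr => i _.
by rewrite cderiveM//= mulrDr mulrA mulrCA.
Qed.

Lemma vderive_sum z (I : Type) (r : seq I) (F : I -> Cvec R m -> C) w :
  (forall i, CCk 1 (F i)) -> U w ->
  vderive z (fun x => \sum_(i <- r) F i x) w = \sum_(i <- r) vderive z (F i) w.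
Proof.
move=> CF Uw; elim: r => [|i r IH].
  rewrite big_nil -[RHS](vderive_cst z 0 w); apply: vderive_eq => // x _; by rewrite big_nil.
rewrite big_cons -IH -vderiveD//; last exact: CCk_sum.
by apply: vderive_eq => // x _; exact: big_cons.
Qed.

Lemma vderive_conj z F w : CCk 1 F -> U w ->
  vderive z (fun x => (F x)^*%C) w = (vderive (fun i => (z i)^*%C) F w)^*%C.
Proof.
move=> CF Uw; rewrite /vderive rmorph_sum; apply: eq_bigr => i _.
by rewrite cderive_conj// rmorphM /= conjcK.
Qed.

(** The components of [y] and [z] are constants, so both sides expand into the same double sum of
    real mixed derivatives, which commute. *)
Lemma vderive_comm y z F w : CCk 2 F -> U w ->
  vderive y (vderive z F) w = vderive z (vderive y F) w.
Proof.
have tt a b G : CCk 2 G -> U w -> vderive a (vderive b G) w =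
    \sum_i \sum_j a i * b j * cderive (dir i) (cderive (dir j) G) w.
  move=> CG Uw; rewrite exchange_big /= [LHS]vderive_sum//; last first.
    by move=> j; apply: CCkM; [exact: CCk_cst|exact: CCk_cderive].
  apply: eq_bigr => j _; rewrite vderiveM ?vderive_cst ?mul0r ?add0r//; last exact: CCk_cderive.
  by rewrite mulr_sumr; apply: eq_bigr => i _; rewrite mulrA (mulrC (b j)).
move=> CF Uw; rewrite !tt// exchange_big; apply: eq_bigr => i _.
by apply: eq_bigr => j _; rewrite (mulrC (y j)) cderive_comm.
Qed.

(** The vector of type (1,0) with components [a] along the d/dw_l, written in the real frame [dir]:
    the boolean is true for the y-directions, which carry the factor -i. *)
Definition hol (a : 'I_m -> C) (i : bool * 'I_m) : C :=
  a i.2 * (2%:R^-1 * if i.1 then - 'i%C else 1).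
Definition antihol (a : 'I_m -> C) (i : bool * 'I_m) : C :=
  a i.2 * (2%:R^-1 * if i.1 then 'i%C else 1).

Lemma vderive_hol a F w : vderive (hol a) F w = \sum_l a l * dw l F w.
Proof.
rewrite /vderive -(pair_bigA _ (fun b l => hol a (b, l) * cderive (dir (b, l)) F w)) /=.
rewrite big_bool -big_split; apply: eq_bigr => l _.
rewrite /hol /dir /dw; cbn [fst snd].
move: (cderive (ey R l) F w) (cderive (ex R l) F w) => X Y.
by move: ('i%C : C) (2%:R^-1 : C) => i h /=; ring.
Qed.

Lemma vderive_antihol a F w : vderive (antihol a) F w = \sum_l a l * dwbar l F w.
Proof.
rewrite /vderive -(pair_bigA _ (fun b l => antihol a (b, l) * cderive (dir (b, l)) F w)) /=.
rewrite big_bool -big_split; apply: eq_bigr => l _.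
rewrite /antihol /dir /dwbar; cbn [fst snd].
move: (cderive (ey R l) F w) (cderive (ex R l) F w) => X Y.
by move: ('i%C : C) (2%:R^-1 : C) => i h /=; ring.
Qed.

Lemma sum_delta (f : 'I_m -> C) k : \sum_l (l == k)%:R * f l = f k.
Proof.
rewrite (bigD1 k)//= eqxx mul1r big1 ?addr0// => l /negPf ->.
by rewrite mul0r.
Qed.

Lemma dw_vderive k F w : dw k F w = vderive (hol (fun l => (l == k)%:R)) F w.
Proof. by rewrite vderive_hol sum_delta. Qed.

Lemma dwbar_vderive k F w : dwbar k F w = vderive (antihol (fun l => (l == k)%:R)) F w.
Proof. by rewrite vderive_antihol sum_delta. Qed.

Lemma hol_conj a i : (hol a i)^*%C = antihol (fun l => (a l)^*%C) i.
Proof.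
rewrite /hol /antihol !rmorphM fmorphV rmorph_nat; congr (_ * (_ * _)).
by case: (i.1); apply/eqP; rewrite eq_complex /= ?opprK ?oppr0 !eqxx.
Qed.

Lemma antihol_conj a i : (antihol a i)^*%C = hol (fun l => (a l)^*%C) i.
Proof.
rewrite /hol /antihol !rmorphM fmorphV rmorph_nat; congr (_ * (_ * _)).
by case: (i.1); apply/eqP; rewrite eq_complex /= ?opprK ?oppr0 !eqxx.
Qed.

Lemma vderive_conj_hol a F w : CCk 1 F -> U w ->
  vderive (hol a) (fun x => (F x)^*%C) w = (vderive (antihol (fun l => (a l)^*%C)) F w)^*%C.
Proof.
move=> CF Uw; rewrite vderive_conj//; congr (_^*%C); apply: eq_bigr => i _.
by rewrite hol_conj.
Qed.

Lemma vderive_conj_antihol a F w : CCk 1 F -> U w ->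
  vderive (antihol a) (fun x => (F x)^*%C) w = (vderive (hol (fun l => (a l)^*%C)) F w)^*%C.
Proof.
move=> CF Uw; rewrite vderive_conj//; congr (_^*%C); apply: eq_bigr => i _.
by rewrite antihol_conj.
Qed.

End ComplexCalculus.

(** * Coordinate functions and holomorphy *)

Section Coordinates.
Variables (R : realType) (m : nat) (U : set (Cvec R m)).
Hypothesis oU : open U.
Local Notation C := R[i].
Implicit Types (F : Cvec R m -> C) (w : Cvec R m) (a b : 'I_m -> C).

Lemma re_coord_lin (k : 'I_m) : linear (fun w : Cvec R m => w.1 0 k).
Proof. by move=> c x y; rewrite /= !mxE. Qed.

Lemma im_coord_lin (k : 'I_m) : linear (fun w : Cvec R m => w.2 0 k).
Proof. by move=> c x y; rewrite /= !mxE. Qed.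

Lemma re_coord_cont (k : 'I_m) : continuous (fun w : Cvec R m => w.1 0 k).
Proof.
move=> w; apply: (@continuous_comp _ _ _ (fun w : Cvec R m => w.1) (fun x : 'rV[R]_m => x 0 k)).
  exact: cvg_fst.
exact: coord_continuous.
Qed.

Lemma im_coord_cont (k : 'I_m) : continuous (fun w : Cvec R m => w.2 0 k).
Proof.
move=> w; apply: (@continuous_comp _ _ _ (fun w : Cvec R m => w.2) (fun x : 'rV[R]_m => x 0 k)).
  exact: cvg_snd.
exact: coord_continuous.
Qed.

Definition re_coord (k : 'I_m) : {linear Cvec R m -> R} :=
  HB.pack (fun w : Cvec R m => w.1 0 k)
    (GRing.isLinear.Build R (Cvec R m) R *:%R _ (re_coord_lin k)).
Definition im_coord (k : 'I_m) : {linear Cvec R m -> R} :=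
  HB.pack (fun w : Cvec R m => w.2 0 k)
    (GRing.isLinear.Build R (Cvec R m) R *:%R _ (im_coord_lin k)).

Lemma CCk_coord j (k : 'I_m) : CCk U j (fun w => coord w k).
Proof.
split; first exact: (Ck_linear oU j (f := re_coord k) (@re_coord_cont k)).
exact: (Ck_linear oU j (f := im_coord k) (@im_coord_cont k)).
Qed.

Lemma derive_linear (f : {linear Cvec R m -> R}) v w : continuous f -> 'D_v f w = f v.
Proof.
by move=> cf; rewrite deriveE ?diff_lin//; exact: linear_differentiable.
Qed.

Lemma cderive_coord v (k : 'I_m) w : cderive v (fun z => coord z k) w = coord v k.
Proof.
exact: (congr2 (@Complex R) (derive_linear (f := re_coord k) v w (@re_coord_cont k))
  (derive_linear (f := im_coord k) v w (@im_coord_cont k))).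
Qed.

Lemma dw_coord (l k : 'I_m) w : dw l (fun z => coord z k) w = (l == k)%:R.
Proof.
rewrite /dw !cderive_coord /coord /ex /ey /= !mxE !eqxx /= eq_sym.
case: (l == k); rewrite /=; last by rewrite !(mulr0, subr0).
have -> : (1 +i* 0 - (0 +i* 1) * (0 +i* 1)) = 2%:R :> C.
  by apply/eqP; rewrite eq_complex /= !(mulr0, mul0r, mulr1, addr0, add0r, subr0, sub0r, opprK, oppr0) !eqxx.
by rewrite mulVf// pnatr_eq0.
Qed.

Lemma dwbar_coord (l k : 'I_m) w : dwbar l (fun z => coord z k) w = 0.
Proof.
rewrite /dwbar !cderive_coord /coord /ex /ey /= !mxE !eqxx /= eq_sym.
case: (l == k); rewrite /=; last by rewrite !(mulr0, addr0).
have -> : (1 +i* 0 + (0 +i* 1) * (0 +i* 1)) = 0 :> C.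
  by apply/eqP; rewrite eq_complex /= !(mulr0, mul0r, mulr1, addr0, add0r, subr0, sub0r, subrr, oppr0) !eqxx.
by rewrite mulr0.
Qed.

(** Holomorphy is taken as the Cauchy-Riemann equations together with the order of differentiability
    that second-order jets demand. *)
Definition holo F := CCk U 2 F /\ forall l w, U w -> dwbar l F w = 0.

Lemma holo_coord (k : 'I_m) : holo (fun w => coord w k).
Proof. by split=> [|l w _]; [exact: CCk_coord|exact: dwbar_coord]. Qed.

Lemma vderive_antihol_holo b F w : holo F -> U w -> vderive (antihol b) F w = 0.
Proof.
by move=> [_ hF] Uw; rewrite vderive_antihol big1// => l _; rewrite hF// mulr0.
Qed.

Lemma vderive_hol_coord a (k : 'I_m) w : vderive (hol a) (fun z => coord z k) w = a k.
Proof.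
rewrite vderive_hol -[RHS](sum_delta a k); apply: eq_bigr => l _.
by rewrite dw_coord mulrC.
Qed.

Lemma dw_comm F (j l : 'I_m) w : CCk U 2 F -> U w -> dw j (dw l F) w = dw l (dw j F) w.
Proof.
move=> CF Uw; rewrite !dw_vderive.
have e (i : 'I_m) : dw i F = vderive (hol (fun l => (l == i)%:R)) F by apply/funext => x; rewrite dw_vderive.
by rewrite !e (vderive_comm oU _ _ CF Uw).
Qed.

End Coordinates.

(** * Second-order jets *)

Section Jets.
Variables (R : realType) (m : nat) (U : set (Cvec R m)).
Hypothesis oU : open U.
Variables (p : Cvec R m) (Up : U p).
Local Notation C := R[i].
Variables (y z : bool * 'I_m -> C).
Implicit Types (F G : Cvec R m -> C).

(** Regularity travels with the values, so that the jet of a composite expression is assembled by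
    the rules below without separate differentiability conditions. In all applications [z] is of
    type (1,0) and [y] of type (0,1). *)
Definition jet F (a b c d : C) := CCk U 2 F /\
  [/\ F p = a, vderive z F p = b, vderive y F p = c & vderive y (vderive z F) p = d].

Lemma jet_eq F a b c d a' b' c' d' :
  jet F a b c d -> a = a' -> b = b' -> c = c' -> d = d' -> jet F a' b' c' d'.
Proof. by move=> ? <- <- <- <-. Qed.

Lemma jet_ext F G a b c d : F =1 G -> jet F a b c d -> jet G a b c d.
Proof. by move=> /funext ->. Qed.

Lemma jet_cst k : jet (fun=> k) k 0 0 0.
Proof.
split; first exact: CCk_cst.
split; rewrite ?vderive_cst// -[RHS](vderive_cst y 0 p).
by apply: (vderive_eq oU) => // w _; rewrite vderive_cst.
Qed.

(** This extracts the scalar equations of first and second order from an identity that holds on the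
    whole open set. *)
Lemma jet_const_on H K a b c d :
  (forall w, U w -> H w = K) -> jet H a b c d -> b = 0 /\ d = 0.
Proof.
move=> HK [CH [_ <- _ <-]]; have t w : U w -> vderive z H w = 0.
  by move=> Uw; rewrite -(vderive_cst z K w); exact: (vderive_eq oU z HK Uw).
by split; [exact: t|rewrite -(vderive_cst y 0 p); exact: (vderive_eq oU)].
Qed.

Lemma jetD F G a b c d a' b' c' d' : jet F a b c d -> jet G a' b' c' d' ->
  jet (fun w => F w + G w) (a + a') (b + b') (c + c') (d + d').
Proof.
move=> [CF [<- <- <- <-]] [CG [<- <- <- <-]]; split; first exact: CCkD.
have CF1 := CCkS CF; have CG1 := CCkS CG.
split; rewrite ?(vderiveD _ CF1 CG1 Up)//.
rewrite -(vderiveD y (CCk_vderive oU z CF) (CCk_vderive oU z CG) Up).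
by apply: (vderive_eq oU) => // w Uw; rewrite (vderiveD z CF1 CG1 Uw).
Qed.

(** By the Leibniz rule the entries multiply like the elements a + b s + c t + d s t of the algebra
    with s^2 = t^2 = 0. *)
Lemma jetM F G a b c d a' b' c' d' : jet F a b c d -> jet G a' b' c' d' ->
  jet (fun w => F w * G w) (a * a') (b * a' + a * b') (c * a' + a * c')
    (d * a' + b * c' + (c * b' + a * d')).
Proof.
move=> [CF [<- <- <- <-]] [CG [<- <- <- <-]]; split; first exact: CCkM.
have CF1 := CCkS CF; have CG1 := CCkS CG.
have CzF := CCk_vderive oU z CF; have CzG := CCk_vderive oU z CG.
split; rewrite ?(vderiveM _ CF1 CG1 Up)//.
rewrite -(vderiveM y CzF CG1 Up) -(vderiveM y CF1 CzG Up).
rewrite -(vderiveD y (CCkM oU CzF CG1) (CCkM oU CF1 CzG) Up).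
by apply: (vderive_eq oU) => // w Uw; rewrite (vderiveM z CF1 CG1 Uw).
Qed.

Lemma jet_sum n (F : 'I_n -> Cvec R m -> C) (a b c d : 'I_n -> C) :
  (forall i, jet (F i) (a i) (b i) (c i) (d i)) ->
  jet (fun w => \sum_i F i w) (\sum_i a i) (\sum_i b i) (\sum_i c i) (\sum_i d i).
Proof.
move=> jF; have CF i : CCk U 2 (F i) by have [] := jF i.
have CF1 i : CCk U 1 (F i) := CCkS (CF i).
split; first exact: CCk_sum.
split; rewrite ?(vderive_sum oU _ _ CF1 Up)//; try by apply: eq_bigr => i _; have [_ []] := jF i.
transitivity (vderive y (fun w => \sum_i vderive z (F i) w) p).
  by apply: (vderive_eq oU) => // w Uw; rewrite (vderive_sum oU z _ CF1 Uw).
rewrite (vderive_sum oU y _ (fun i => CCk_vderive oU z (CF i)) Up).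
by apply: eq_bigr => i _; have [_ []] := jF i.
Qed.

End Jets.

(** The mixed entry vanishes because the two derivations commute and the (0,1)-derivative is zero on
    all of [U]. *)
Lemma jet_holo (R : realType) (m : nat) (U : set (Cvec R m)) p (a b : 'I_m -> R[i]) F :
  open U -> U p -> holo U F ->
  jet U p (antihol b) (hol a) F (F p) (vderive (hol a) F p) 0 0.
Proof.
move=> oU Up hF; have [CF _] := hF; split=> //.
have h0 w : U w -> vderive (antihol b) F w = 0 by exact: vderive_antihol_holo.
split; rewrite ?h0// (vderive_comm oU _ _ CF Up) -(vderive_cst (hol a) 0 p).
exact: (vderive_eq oU).
Qed.

Lemma jet_conj_holo (R : realType) (m : nat) (U : set (Cvec R m)) p (a b : 'I_m -> R[i]) F :
  open U -> U p -> holo U F ->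
  jet U p (antihol b) (hol a) (fun w => (F w)^*%C)
    (F p)^*%C 0 (vderive (hol (fun l => (b l)^*%C)) F p)^*%C 0.
Proof.
move=> oU Up hF; have [CF _] := hF; have CF1 := CCkS CF; split; first exact: CCk_conj.
have h0 w : U w -> vderive (hol a) (fun w => (F w)^*%C) w = 0.
  by move=> Uw; rewrite (vderive_conj_hol oU _ CF1 Uw) (vderive_antihol_holo _ hF Uw) rmorph0.
split; rewrite ?h0 ?(vderive_conj_antihol oU _ CF1 Up)//.
by rewrite -(vderive_cst (antihol b) 0 p); exact: (vderive_eq oU).
Qed.

(** * Splitting the indices into those of w' and that of w_n *)

Section Ordinals.
Variable n : nat.
Local Notation W := (widen_ord (leqnSn n)).
Local Notation top := (@ord_max n).

Lemma ord_max_ind (P : 'I_n.+1 -> Prop) : P top -> (forall k, P (W k)) -> forall i, P i.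
Proof.
move=> Pt PW i; case: (ltnP i n) => [lt|ge].
  by have -> : i = W (Ordinal lt) by apply/val_inj.
suff -> : i = top by [].
by apply/val_inj/eqP; rewrite /= eqn_leq ge -ltnS ltn_ord.
Qed.

Lemma widen_eq_max (k : 'I_n) : (W k == top) = false.
Proof. by apply/negbTE; rewrite -val_eqE /= neq_ltn ltn_ord. Qed.

Lemma max_eq_widen (k : 'I_n) : (top == W k) = false.
Proof. by rewrite eq_sym widen_eq_max. Qed.

Lemma widen_eq (k l : 'I_n) : (W k == W l) = (k == l).
Proof. by rewrite -!val_eqE. Qed.

End Ordinals.

Lemma continuous_Ck (R : realType) (V : normedModType R) (f : V -> R) :
  Ck setT 1 f -> continuous f.
Proof. by move=> [df _] w; apply: differentiable_continuous; exact: df. Qed.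

(** * The Siegel domain *)

Section Siegel.
Variables (R : realType) (n : nat).
Local Notation C := R[i].
Local Notation S := (siegel R n).
Local Notation W := (widen_ord (leqnSn n)).
Local Notation top := (@ord_max n).
Implicit Types (w : Cvec R n.+1).

(** The function D as a complex polynomial in the coordinates and their conjugates, the form to
    which the jet rules apply. *)
Definition cdefect w : C :=
  2%:R^-1 * (coord w top + (coord w top)^*%C)
  - \sum_k coord w (W k) * (coord w (W k))^*%C.

Lemma cdefectE w : (siegel_defect w)%:C = cdefect w.
Proof.
rewrite /cdefect addcJ mulKf ?pnatr_eq0// /siegel_defect rmorphB rmorph_sum; congr (_ - _).
apply: eq_bigr => k _; rewrite /modulus_sq; case: (coord w (W k)) => a b.
by apply/eqP; rewrite eq_complex /=; apply/andP; split; apply/eqP; ring.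
Qed.

Lemma siegelE w : S w <-> 0 < siegel_defect w.
Proof. by rewrite /siegel /siegel_defect /= subr_gt0. Qed.

Lemma CCk_cdefect (U : set (Cvec R n.+1)) k : open U -> CCk U k cdefect.
Proof.
move=> oU; apply: (CCkD oU).
  apply: (CCkM oU); first exact: CCk_cst.
  by apply: (CCkD oU); [exact: CCk_coord|apply: (CCk_conj oU); exact: CCk_coord].
apply: (CCk_eq oU (F := fun w => -1 * \sum_k coord w (W k) * (coord w (W k))^*%C)).
  by move=> w _; rewrite mulN1r.
apply: (CCkM oU); first exact: CCk_cst.
apply: (CCk_sum oU) => i; apply: (CCkM oU); first exact: CCk_coord.
by apply: (CCk_conj oU); exact: CCk_coord.
Qed.

Lemma Ck_siegel_defect (U : set (Cvec R n.+1)) k : open U -> Ck U k (@siegel_defect R n).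
Proof.
move=> oU; have [C1 _] := CCk_cdefect k oU; apply: (Ck_eq oU _ C1) => w _.
by rewrite -cdefectE.
Qed.

Lemma open_siegel : open S.
Proof.
have -> : S = (@siegel_defect R n) @^-1` [set x | 0 < x].
  by apply/seteqP; split=> w /siegelE.
apply: open_comp; last exact: open_gt.
by move=> w _; apply: continuous_Ck; exact: (Ck_siegel_defect 1 openT).
Qed.

(** The direction vector [ex R top], read as a point, is the one with w' = 0 and w_n = 1. *)
Local Notation p := (ex R top).

Lemma coord_p_top : coord p top = 1.
Proof. by rewrite /coord /ex /= !mxE !eqxx. Qed.

Lemma coord_p k : coord p (W k) = 0.
Proof.
rewrite /coord /ex /= !mxE eqxx /=.
by rewrite widen_eq_max.
Qed.

Lemma siegel_p : S p.
Proof.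
apply/siegelE; rewrite -ltcR cdefectE /cdefect coord_p_top big1 ?subr0.
  by rewrite conjc1 -[1 + 1]/(2%:R) mulVf// pnatr_eq0.
by move=> k _; rewrite coord_p mul0r.
Qed.

(** Arbitrary base points serve to compute the Bergman metric; [jet_cdefect] below is the
    specialization to [p]. *)
Lemma jet_cdefect_at (U : set (Cvec R n.+1)) w (a b : 'I_n.+1 -> C) :
  open U -> U w -> jet U w (antihol b) (hol a) cdefect (cdefect w)
    (2%:R^-1 * a top - \sum_k a (W k) * (coord w (W k))^*%C)
    (2%:R^-1 * b top - \sum_k coord w (W k) * b (W k))
    (- \sum_k a (W k) * b (W k)).
Proof.
move=> oU Uw.
have j1 k := jet_holo a b oU Uw (holo_coord oU k).
have j2 k := jet_conj_holo a b oU Uw (holo_coord oU k).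
have jc k := jet_cst oU Uw (antihol b) (hol a) k.
have j3 := jet_sum oU Uw (fun k => jetM oU Uw (j1 (W k)) (j2 (W k))).
have := jetD oU Uw (jetM oU Uw (jc 2%:R^-1) (jetD oU Uw (j1 top) (j2 top)))
          (jetM oU Uw (jc (-1)) j3).
move=> /(@jet_ext _ _ _ _ _ _ _ cdefect) j.
apply: (jet_eq (j _)); first by move=> x; rewrite mulN1r.
- by rewrite mulN1r.
- rewrite !(mul0r, add0r, addr0) mulN1r vderive_hol_coord; congr (_ - _).
  by apply: eq_bigr => k _; rewrite vderive_hol_coord mulr0 addr0.
- rewrite !(mul0r, add0r, addr0) mulN1r vderive_hol_coord conjcK; congr (_ - _).
  by apply: eq_bigr => k _; rewrite vderive_hol_coord mul0r add0r conjcK.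
rewrite !(mul0r, add0r, addr0, mulr0) mulN1r; congr (- _).
by apply: eq_bigr => k _; rewrite !vderive_hol_coord conjcK !(mul0r, mulr0, addr0, add0r).
Qed.

Lemma jet_cdefect (a b : 'I_n.+1 -> C) :
  jet S p (antihol b) (hol a) cdefect 1 (2%:R^-1 * a top) (2%:R^-1 * b top)
    (- \sum_k a (W k) * b (W k)).
Proof.
apply: (jet_eq (jet_cdefect_at a b open_siegel siegel_p)) => //.
- rewrite /cdefect coord_p_top big1 ?subr0.
    by rewrite conjc1 -[1 + 1]/(2%:R) mulVf// pnatr_eq0.
  by move=> k _; rewrite coord_p mul0r.
- by rewrite big1 ?subr0// => k _; rewrite coord_p conjc0 mulr0.
- by rewrite big1 ?subr0// => k _; rewrite coord_p mul0r.
Qed.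

End Siegel.

(** * The second-order argument at p *)

Section Core.
Variables (R : realType) (n : nat).
Local Notation C := R[i].
Local Notation S := (siegel R n).
Local Notation W := (widen_ord (leqnSn n)).
Local Notation top := (@ord_max n).
Local Notation p := (ex R top).
Variables (h : 'I_n.+1 -> Cvec R n.+1 -> C) (N K : C).
Hypothesis holo_h : forall l, holo S (h l).

(* N (||d eta||^2 - N) after the substitution d eta/dw_l = h_l - N d(log D)/dw_l;
   see reduced_norm_potential. *)
Definition reduced_norm (w : Cvec R n.+1) : C :=
  cdefect w *
  (\sum_k (h (W k) w + 2%:R * (coord w (W k))^*%C * h top w)
          * ((h (W k) w)^*%C + 2%:R * coord w (W k) * (h top w)^*%C)
   + 4%:R * (cdefect w * (h top w * (h top w)^*%C))
   - 2%:R * N * (h top w + (h top w)^*%C)).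

Local Notation x := (fun k => h (W k) p).
Local Notation X := (h top p).

Section Direction.
Variable a : 'I_n.+1 -> C.
Local Notation b := (fun l => (a l)^*%C).
Local Notation y := (fun k => vderive (hol a) (h (W k)) p).
Local Notation Y := (vderive (hol a) (h top) p).
Local Notation q := (\sum_k a (W k) * b (W k)).

(** [jetQ0] to [jetQ3] are the four jet entries at [p] of the second factor of [reduced_norm], for
    the (1,0)-direction [a] and its conjugate. Lower-case letters belong to w' and capitals to w_n:
    [x], [X] are values of the h_l, and [y], [Y] their derivatives along [a]. *)
Definition jetQ0 : C :=
  \sum_k x k * (x k)^*%C + 4%:R * (X * X^*%C) - 2%:R * N * (X + X^*%C).
Definition jetQ1 : C :=
  \sum_k (y k * (x k)^*%C + 2%:R * a (W k) * x k * X^*%C)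
  + 4%:R * (2%:R^-1 * a top * (X * X^*%C) + Y * X^*%C) - 2%:R * N * Y.
Definition jetQ2 : C :=
  \sum_k (2%:R * b (W k) * X * (x k)^*%C + x k * (y k)^*%C)
  + 4%:R * (2%:R^-1 * b top * (X * X^*%C) + X * Y^*%C) - 2%:R * N * Y^*%C.
Definition jetQ3 : C :=
  \sum_k (2%:R * b (W k) * Y * (x k)^*%C + y k * (y k)^*%C
          + 4%:R * a (W k) * b (W k) * (X * X^*%C) + 2%:R * a (W k) * x k * Y^*%C)
  + 4%:R * (- q * (X * X^*%C) + 2%:R^-1 * a top * (X * Y^*%C)
            + 2%:R^-1 * b top * (Y * X^*%C) + Y * Y^*%C).

Lemma jet_reduced_norm : jet S p (antihol b) (hol a) reduced_norm jetQ0
  (2%:R^-1 * a top * jetQ0 + jetQ1) (2%:R^-1 * b top * jetQ0 + jetQ2)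
  (- q * jetQ0 + 2%:R^-1 * a top * jetQ2 + (2%:R^-1 * b top * jetQ1 + jetQ3)).
Proof.
have oS := @open_siegel R n; have Sp := @siegel_p R n.
have ba : (fun l => (b l)^*%C) = a by apply/funext => l; rewrite conjcK.
have jc k := jet_cst oS Sp (antihol b) (hol a) k.
have jD := jet_cdefect a b.
have jw k : jet S p (antihol b) (hol a) (fun w => coord w (W k)) 0 (a (W k)) 0 0.
  apply: (jet_eq (jet_holo a b oS Sp (holo_coord oS (W k)))) => //.
    exact: coord_p.
  by rewrite vderive_hol_coord.
have jw' k : jet S p (antihol b) (hol a) (fun w => (coord w (W k))^*%C) 0 0 (b (W k)) 0.
  apply: (jet_eq (jet_conj_holo a b oS Sp (holo_coord oS (W k)))) => //.
    by rewrite coord_p conjc0.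
  by rewrite vderive_hol_coord conjcK.
have jh l := jet_holo a b oS Sp (holo_h l).
have jh' l : jet S p (antihol b) (hol a) (fun w => (h l w)^*%C)
    (h l p)^*%C 0 (vderive (hol a) (h l) p)^*%C 0.
  by apply: (jet_eq (jet_conj_holo a b oS Sp (holo_h l))) => //; rewrite ba.
(* The conjugate of w_k vanishes at [p] but its (0,1)-derivative is [b (W k)], which is where the
   last two entries come from. *)
have jF k : jet S p (antihol b) (hol a)
    (fun w => h (W k) w + 2%:R * (coord w (W k))^*%C * h top w)
    (x k) (y k) (2%:R * b (W k) * X) (2%:R * b (W k) * Y).
  apply: (jet_eq (jetD oS Sp (jh (W k)) (jetM oS Sp (jetM oS Sp (jc 2%:R) (jw' k)) (jh top)))); ring.
have jG k : jet S p (antihol b) (hol a)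
    (fun w => (h (W k) w)^*%C + 2%:R * coord w (W k) * (h top w)^*%C)
    (x k)^*%C (2%:R * a (W k) * X^*%C) (y k)^*%C (2%:R * a (W k) * Y^*%C).
  apply: (jet_eq (jetD oS Sp (jh' (W k)) (jetM oS Sp (jetM oS Sp (jc 2%:R) (jw k)) (jh' top)))); ring.
have jS := jet_sum oS Sp (fun k => jetM oS Sp (jF k) (jG k)).
have jX := jetM oS Sp (jh top) (jh' top).
have jT := jetM oS Sp (jc 4%:R) (jetM oS Sp jD jX).
have jU := jetM oS Sp (jc (- (2%:R * N))) (jetD oS Sp (jh top) (jh' top)).
have jQ : jet S p (antihol b) (hol a) (fun w =>
   \sum_k (h (W k) w + 2%:R * (coord w (W k))^*%C * h top w)
          * ((h (W k) w)^*%C + 2%:R * coord w (W k) * (h top w)^*%C)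
   + 4%:R * (cdefect w * (h top w * (h top w)^*%C))
   - 2%:R * N * (h top w + (h top w)^*%C)) jetQ0 jetQ1 jetQ2 jetQ3.
  have := @jet_ext _ _ _ _ _ _ _ _ _ _ _ _ _ (jetD oS Sp (jetD oS Sp jS jT) jU).
  move=> j; apply: (jet_eq (j _ _)); first by move=> w; rewrite mulNr.
  - rewrite /jetQ0; ring.
  - rewrite /jetQ1 (eq_bigr (fun k => y k * (x k)^*%C + 2%:R * a (W k) * x k * X^*%C)).
      by ring.
    by move=> k _; ring.
  - rewrite /jetQ2 (eq_bigr (fun k => 2%:R * b (W k) * X * (x k)^*%C + x k * (y k)^*%C)).
      by ring.
    by move=> k _; ring.
  - rewrite /jetQ3 (eq_bigr (fun k => 2%:R * b (W k) * Y * (x k)^*%C + y k * (y k)^*%C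
          + 4%:R * a (W k) * b (W k) * (X * X^*%C) + 2%:R * a (W k) * x k * Y^*%C)).
      by ring.
    by move=> k _; ring.
apply: (jet_eq (jetM oS Sp jD jQ)); ring.
Qed.

End Direction.
Hypothesis hess_sym : forall j l, dw j (h l) p = dw l (h j) p.
Hypothesis reduced_norm_cst : forall w, S w -> reduced_norm w = K.
Hypothesis N_gt0 : 0 < N.
Hypothesis K_real : K^*%C = K.

Let N_real : N^*%C = N.
Proof. by move: N_gt0; case: (N) => c d; rewrite ltcE /= => /andP[/eqP -> _]; rewrite oppr0. Qed.

Lemma jetQ0E : jetQ0 = K.
Proof.
(* The value entry does not depend on the direction, so the zero direction serves. *)
have [_ [<- _ _ _]] := jet_reduced_norm (fun=> 0).
exact: reduced_norm_cst (siegel_p R n).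
Qed.

Lemma norm_orders a : 2%:R^-1 * a top * K + jetQ1 a = 0 /\
  - (\sum_k a (W k) * (a (W k))^*%C) * K + 2%:R^-1 * a top * jetQ2 a
    + (2%:R^-1 * (a top)^*%C * jetQ1 a + jetQ3 a) = 0.
Proof.
have := jet_const_on (@open_siegel R n) (siegel_p R n) reduced_norm_cst (jet_reduced_norm a).
by rewrite jetQ0E.
Qed.

Local Notation e l := (fun j => (j == l)%:R : C).

Lemma first_order l : 2%:R^-1 * e l top * K +
  (\sum_k (dw l (h (W k)) p * (x k)^*%C + 2%:R * e l (W k) * x k * X^*%C)
   + 4%:R * (2%:R^-1 * e l top * (X * X^*%C) + dw l (h top) p * X^*%C)
   - 2%:R * N * dw l (h top) p) = 0.
Proof.
have [E _] := norm_orders (e l); rewrite -[RHS]E /jetQ1 !dw_vderive; congr (_ + (_ + _ - _)).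
by apply: eq_bigr => k _; rewrite dw_vderive.
Qed.

(* N times the (1,0)-gradient of the potential at p. *)
Definition grad (l : 'I_n.+1) : C :=
  if l == top then 4%:R * X^*%C - 2%:R * N else (h l p)^*%C.

Lemma grad_top : grad top = 4%:R * X^*%C - 2%:R * N.
Proof. by rewrite /grad eqxx. Qed.

Lemma grad_W k : grad (W k) = (x k)^*%C.
Proof. by rewrite /grad widen_eq_max. Qed.

(** In [first_order] the derivatives dh_k/dw_l have exactly the components of [grad] as
    coefficients. Symmetry of the Hessian exchanges k and l, and their sum becomes the derivative of
    h_l along [grad]. *)
Lemma vderive_grad l : vderive (hol grad) (h l) p =
  - (2%:R * \sum_k e l (W k) * x k) * X^*%C
  - e l top * (2%:R^-1 * K + 2%:R * (X * X^*%C)).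
Proof.
have := first_order l; rewrite big_split /=.
have -> : \sum_k (2%:R * e l (W k) * x k * X^*%C) = 2%:R * (\sum_k e l (W k) * x k) * X^*%C.
  by rewrite mulr_sumr mulr_suml; apply: eq_bigr => k _; ring.
move=> E; rewrite vderive_hol big_ord_recr /= grad_top hess_sym.
rewrite (eq_bigr (fun k => dw l (h (W k)) p * (x k)^*%C)); last first.
  by move=> k _; rewrite grad_W hess_sym mulrC.
apply/eqP; rewrite -subr_eq0 -[X in _ == X]E; apply/eqP.
by field.
Qed.

Lemma vderive_grad_W k : vderive (hol grad) (h (W k)) p = - 2%:R * x k * X^*%C.
Proof.
rewrite vderive_grad eq_sym widen_eq_max mul0r subr0.
have -> : \sum_j e (W k) (W j) * x j = x k.
  rewrite (bigD1 k)//= eqxx mul1r big1 ?addr0// => j jk.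
  suff -> : (W j == W k) = false by rewrite mul0r.
  by apply/negbTE; move: jk; rewrite -!val_eqE.
by ring.
Qed.

Lemma vderive_grad_top :
  vderive (hol grad) (h top) p = - (2%:R^-1 * K + 2%:R * (X * X^*%C)).
Proof.
rewrite vderive_grad eqxx mul1r big1 ?mulr0 ?oppr0 ?mul0r ?add0r//.
by move=> k _; rewrite widen_eq_max mul0r.
Qed.

(** Along [grad] every derivative of the h_l is known from [vderive_grad], so the second-order
    equation involves only [X], K, N and the sum [s] of the |x_k|^2. *)
Lemma constant_quadratic_eq : K * (K + N ^+ 2) = 0.
Proof.
have [_ E] := norm_orders grad.
have Q0 := jetQ0E; rewrite /jetQ0 in Q0.
set s := \sum_k _ in Q0.
have qE : \sum_k grad (W k) * (grad (W k))^*%C = s.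
  by apply: eq_bigr => k _; rewrite grad_W conjcK mulrC.
(* By [vderive_grad_top] this derivative is a combination of K and |X|^2, both real. *)
have Yc : (vderive (hol grad) (h top) p)^*%C = vderive (hol grad) (h top) p.
  rewrite vderive_grad_top rmorphN rmorphD !rmorphM fmorphV !rmorph_nat /= conjcK K_real.
  by rewrite (mulrC X^*%C).
have Q1 : jetQ1 grad = 4%:R * (2%:R^-1 * grad top * (X * X^*%C) +
    vderive (hol grad) (h top) p * X^*%C) - 2%:R * N * vderive (hol grad) (h top) p.
  rewrite /jetQ1 big1 ?add0r// => k _; rewrite vderive_grad_W grad_W; ring.
have Q2 : jetQ2 grad = 4%:R * (2%:R^-1 * (grad top)^*%C * (X * X^*%C) +
    X * vderive (hol grad) (h top) p) - 2%:R * N * vderive (hol grad) (h top) p.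
  rewrite /jetQ2 Yc big1 ?add0r// => k _; rewrite vderive_grad_W grad_W conjcK.
  by rewrite !rmorphM rmorphN rmorph_nat /= conjcK; ring.
have Q3 : jetQ3 grad = s * (4%:R * vderive (hol grad) (h top) p + 8%:R * (X * X^*%C))
  + 4%:R * (- s * (X * X^*%C)
    + 2%:R^-1 * grad top * (X * vderive (hol grad) (h top) p)
    + 2%:R^-1 * (grad top)^*%C * (vderive (hol grad) (h top) p * X^*%C)
    + vderive (hol grad) (h top) p * vderive (hol grad) (h top) p).
  rewrite /jetQ3 Yc qE; congr (_ + _); rewrite /s mulr_suml; apply: eq_bigr => k _.
  rewrite vderive_grad_W grad_W conjcK.
  by rewrite !rmorphM rmorphN rmorph_nat /= conjcK; ring.
have gtc : (grad top)^*%C = 4%:R * X - 2%:R * N.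
  by rewrite grad_top rmorphB !rmorphM !rmorph_nat /= conjcK N_real.
move: E; rewrite qE Q1 Q2 Q3 gtc grad_top vderive_grad_top.
(* The zeroth-order equation eliminates [s]; then all terms in [X] cancel and the left-hand side of
   [E] is -2 K (K + N^2). *)
have -> : s = K - 4%:R * (X * X^*%C) + 2%:R * N * (X + X^*%C) by rewrite -Q0; ring.
move=> E; apply: (@mulfI _ (- 2%:R)); first by rewrite oppr_eq0 pnatr_eq0.
by rewrite mulr0 -[RHS]E; field.
Qed.

(** In the excluded case the zeroth-order equation forces [grad] to vanish, so that direction gives
    no information. The direction d/dw_n is used instead and yields a strictly positive quantity
    equal to 0. *)
Lemma constant_neq : K + N ^+ 2 != 0.
Proof.
apply/eqP => K0; have Q0 := jetQ0E; rewrite /jetQ0 in Q0.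
have J (c : C) : 0 <= c * c^*%C by exact: mulcJ_ge0.
have c0 (c : C) : c * c^*%C = 0 -> c = 0.
  by move/eqP; rewrite mulf_eq0 conjc_eq0 orbb => /eqP.
have s0 : 0 <= \sum_k x k * (x k)^*%C by apply: sumr_ge0.
(* Completing the square: with K = -N^2 the value equation reads sum |x_k|^2 + 4 |d|^2 = 0. *)
set d := X - 2%:R^-1 * N.
have dc : d^*%C = X^*%C - 2%:R^-1 * N by rewrite rmorphB rmorphM fmorphV rmorph_nat /= N_real.
have sum0 : \sum_k x k * (x k)^*%C + 4%:R * (d * d^*%C) = 0.
  by rewrite -[RHS]K0 -Q0 dc /d; field.
have [sx0 sd0] : \sum_k x k * (x k)^*%C = 0 /\ d * d^*%C = 0.
  have d0 : 0 <= 4%:R * (d * d^*%C) by rewrite mulr_ge0.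
  move/eqP: sum0; rewrite paddr_eq0// => /andP[/eqP -> /eqP/eqP].
  by rewrite mulf_eq0 pnatr_eq0 /= => /eqP.
have x0 k : x k = 0 by apply: c0; apply: (psumr_eq0P _ sx0).
have XE : X = 2%:R^-1 * N by apply/eqP; rewrite -subr_eq0; apply/eqP; exact: c0.
have XcE : X^*%C = 2%:R^-1 * N by rewrite XE rmorphM fmorphV rmorph_nat /= N_real.
have [_ E] := norm_orders (e top).
set Y := vderive (hol (e top)) (h top) p.
set T := \sum_k vderive (hol (e top)) (h (W k)) p * (vderive (hol (e top)) (h (W k)) p)^*%C.
have Q1 : jetQ1 (e top) = 2%:R^-1 * N ^+ 2.
  rewrite /jetQ1 big1 => [|k _]; last by rewrite x0 conjc0 widen_eq_max; ring.
  by rewrite eqxx XcE XE -/Y /= mulr1n; field.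
have Q2 : jetQ2 (e top) = 2%:R^-1 * N ^+ 2.
  rewrite /jetQ2 big1 => [|k _]; last by rewrite x0 conjc0 widen_eq_max conjc0; ring.
  by rewrite eqxx conjc1 XcE XE -/Y /= ; field.
have q0 : \sum_k e top (W k) * (e top (W k))^*%C = 0.
  by rewrite big1// => k _; rewrite widen_eq_max mul0r.
have Q3 : jetQ3 (e top) = T + N * (Y + Y^*%C) + 4%:R * (Y * Y^*%C).
  rewrite /jetQ3 q0 (eq_bigr (fun k => vderive (hol (e top)) (h (W k)) p
     * (vderive (hol (e top)) (h (W k)) p)^*%C)); last first.
    by move=> k _; rewrite x0 conjc0 widen_eq_max conjc0; ring.
  by rewrite -/T -/Y eqxx conjc1 XcE XE /= mulr1n; field.
move: E; rewrite q0 Q1 Q2 Q3 eqxx conjc1.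
(* The first-order entries contribute N^2/2 in all. Half of it completes N (Y + conj Y) + 4 |Y|^2 to
   |f|^2, and N^2/4 is left over. *)
set f := 2%:R * Y + 2%:R^-1 * N.
have fc : f^*%C = 2%:R * Y^*%C + 2%:R^-1 * N by rewrite rmorphD !rmorphM fmorphV rmorph_nat /= N_real.
have -> : - 0 * K + 2%:R^-1 * 1 * (2%:R^-1 * N ^+ 2) + (2%:R^-1 * 1 * (2%:R^-1 * N ^+ 2)
   + (T + N * (Y + Y^*%C) + 4%:R * (Y * Y^*%C))) = T + f * f^*%C + 4%:R^-1 * N ^+ 2.
  by rewrite fc /f; field.
have T0 : 0 <= T by apply: sumr_ge0.
move/eqP; rewrite gt_eqF//; apply: ltr_wpDl; first by rewrite addr_ge0.
by rewrite mulr_gt0// ?invr_gt0 ?ltr0n// exprn_gt0.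
Qed.

Lemma reduced_norm_eq0 : K = 0.
Proof. by move/eqP: constant_quadratic_eq; rewrite mulf_eq0 (negbTE constant_neq) orbF => /eqP. Qed.

End Core.

(** * The Bergman metric and its inverse *)

Section SiegelMatrix.
Variables (F : numFieldType) (n : nat) (D M : F) (c cb : 'I_n -> F).
Local Notation W := (widen_ord (leqnSn n)).
Local Notation top := (@ord_max n).
Hypotheses (D0 : D != 0) (M0 : M != 0).

Variables (g q : 'M[F]_n.+1).
Hypothesis gWW : forall k l, g (W k) (W l) = M * (cb k * c l / D ^+ 2 + (k == l)%:R / D).
Hypothesis gWt : forall k, g (W k) top = - M * cb k / (2%:R * D ^+ 2).
Hypothesis gtW : forall l, g top (W l) = - M * c l / (2%:R * D ^+ 2).
Hypothesis gtt : g top top = M / (4%:R * D ^+ 2).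
Hypothesis qWW : forall k l, q (W k) (W l) = D / M * (k == l)%:R.
Hypothesis qWt : forall k, q (W k) top = D / M * (2%:R * cb k).
Hypothesis qtW : forall l, q top (W l) = D / M * (2%:R * c l).
Hypothesis qtt : q top top = D / M * (4%:R * (D + \sum_k c k * cb k)).

Lemma sum_deltar (f : 'I_n -> F) l : \sum_k f k * (k == l)%:R = f l.
Proof.
rewrite (bigD1 l)//= eqxx mulr1 big1 ?addr0// => k /negPf ->.
by rewrite mulr0.
Qed.

(** Here [D], [M], [c] and [cb] stand for the defect, the factor N, w' and its conjugate. Treated as
    independent field elements, they reduce each of the four blocks to a rational identity once the
    Kronecker deltas are summed. *)
Lemma siegel_mulV : g *m q = 1%:M.
Proof.
apply/matrixP; elim/ord_max_ind => [|k]; elim/ord_max_ind => [|l]; rewrite !mxE big_ord_recr /=.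
- rewrite (eq_bigr (fun k => - D^-1 * (c k * cb k))) -?mulr_sumr; last first.
    by move=> k _; rewrite gtW qWt; field; rewrite D0 M0.
  by rewrite gtt qtt eqxx mulr1n; field; rewrite D0 M0.
- rewrite (eq_bigr (fun k => - c k / (2%:R * D) * (k == l)%:R)) ?sum_deltar; last first.
    by move=> k _; rewrite gtW qWW; field; rewrite D0 M0.
  by rewrite gtt qtW max_eq_widen mulr0n; field; rewrite D0 M0.
- rewrite (eq_bigr (fun j => 2%:R * cb k / D * (c j * cb j)
      + 2%:R * cb j * (j == k)%:R)); last first.
    by move=> j _; rewrite gWW qWt (eq_sym k j); field; rewrite D0 M0.
  rewrite big_split /= sum_deltar -mulr_sumr gWt qtt widen_eq_max mulr0n.
  by field; rewrite D0 M0.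
- rewrite (eq_bigr (fun j => (cb k * c j / D + (k == j)%:R) * (j == l)%:R)); last first.
    by move=> j _; rewrite gWW qWW; field; rewrite D0 M0.
  by rewrite sum_deltar gWt qtW widen_eq; field; rewrite D0 M0.
Qed.

(** The form becomes diagonal in the frame d/dw_k + 2 conj(w_k) d/dw_n, d/dw_n. The first n of these
    fields annihilate D, that is, they are tangent to its level sets. *)
Lemma siegel_form (f h : 'I_n.+1 -> F) :
  \sum_k \sum_j q j k * f k * h j =
  D / M * (\sum_k (f (W k) + 2%:R * cb k * f top) * (h (W k) + 2%:R * c k * h top)
           + 4%:R * (D * (f top * h top))).
Proof.
have inner k : \sum_j q j (W k) * f (W k) * h j =
    D / M * (f (W k) * h (W k) + 2%:R * c k * f (W k) * h top).
  rewrite big_ord_recr /= qtW.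
  rewrite (eq_bigr (fun j => D / M * f (W k) * h (W j) * (j == k)%:R)); last first.
    by move=> j _; rewrite qWW; ring.
  by rewrite sum_deltar; ring.
have last : \sum_j q j top * f top * h j = D / M * (\sum_j 2%:R * cb j * f top * h (W j)
    + 4%:R * (D + \sum_k c k * cb k) * f top * h top).
  rewrite big_ord_recr /= qtt [RHS]mulrDr [in RHS]mulr_sumr; congr (_ + _); last by ring.
  by apply: eq_bigr => j _; rewrite qWt; ring.
rewrite big_ord_recr /= last (eq_bigr _ (fun k _ => inner k)) -mulr_sumr.
rewrite -mulrDr; congr (_ * _).
have -> : \sum_k (f (W k) + 2%:R * cb k * f top) * (h (W k) + 2%:R * c k * h top) =
  \sum_k (f (W k) * h (W k) + 2%:R * c k * f (W k) * h top)
  + (\sum_j 2%:R * cb j * f top * h (W j) + (\sum_k c k * cb k) * (4%:R * f top * h top)).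
  by rewrite mulr_suml -!big_split; apply: eq_bigr => k _ /=; ring.
by ring.
Qed.

End SiegelMatrix.

Section Metric.
Variables (R : realType) (n : nat).
Local Notation C := R[i].
Local Notation S := (siegel R n).
Local Notation W := (widen_ord (leqnSn n)).
Local Notation top := (@ord_max n).
Local Notation N := ((n.+2)%:R : C).
Implicit Types (w : Cvec R n.+1).

Let oS : open S := @open_siegel R n.

Lemma cdefect_gt0 w : S w -> 0 < cdefect w.
Proof. by move=> /siegelE; rewrite -ltcR cdefectE. Qed.

Lemma cdefect_neq0 w : S w -> cdefect w != 0.
Proof. by move=> /cdefect_gt0; rewrite lt0r => /andP[]. Qed.

(** [defect10], [defect01] and [defect11] are the closed forms of the coefficients of dD, dbar D and
    d dbar D. *)
Definition defect10 w (i : 'I_n.+1) : C :=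
  if i == top then 2%:R^-1 else - (coord w i)^*%C.
Definition defect01 w (j : 'I_n.+1) : C :=
  if j == top then 2%:R^-1 else - coord w j.
Definition defect11 (i j : 'I_n.+1) : C := - ((i == j) && (i != top))%:R.

Lemma sum_delta_W (f : 'I_n.+1 -> C) (l : 'I_n.+1) :
  \sum_k (W k == l)%:R * f (W k) = if l == top then 0 else f l.
Proof.
rewrite -[in RHS](sum_delta f l) big_ord_recr /=.
case: (eqVneq l top) => [->|_]; first by rewrite big1// => k _; rewrite widen_eq_max mul0r.
by rewrite mul0r addr0.
Qed.

Lemma dw_cdefect i w : S w -> dw i (@cdefect R n) w = defect10 w i.
Proof.
move=> Sw; rewrite dw_vderive.
have [_ [_ -> _ _]] := jet_cdefect_at (fun l => (l == i)%:R) (fun=> 0) oS Sw.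
rewrite (sum_delta_W (fun k => (coord w k)^*%C)) /defect10 [top == i]eq_sym.
by case: (i == top); rewrite ?mulr1 ?subr0// mulr0 sub0r.
Qed.

Lemma dwbar_cdefect j w : S w -> dwbar j (@cdefect R n) w = defect01 w j.
Proof.
move=> Sw; rewrite dwbar_vderive.
have [_ [_ _ -> _]] := jet_cdefect_at (fun=> 0) (fun l => (l == j)%:R) oS Sw.
under eq_bigr do rewrite mulrC.
rewrite (sum_delta_W (fun k => coord w k)) /defect01 [top == j]eq_sym.
by case: (j == top); rewrite ?mulr1 ?subr0// mulr0 sub0r.
Qed.

Lemma dw_dwbar_cdefect i j w : S w -> dw i (dwbar j (@cdefect R n)) w = defect11 i j.
Proof.
move=> Sw; rewrite dw_vderive.
have -> : dwbar j (@cdefect R n) = vderive (antihol (fun l => (l == j)%:R)) (@cdefect R n).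
  by apply/funext => x; rewrite dwbar_vderive.
rewrite (vderive_comm oS _ _ (CCk_cdefect 2 oS) Sw).
have [_ [_ _ _ ->]] := jet_cdefect_at (fun l => (l == i)%:R) (fun l => (l == j)%:R) oS Sw.
rewrite (sum_delta_W (fun k => (k == j)%:R)) /defect11.
by case: (eqVneq i top) => /=; rewrite ?andbF ?andbT.
Qed.

Lemma Ck_ln_defect k : Ck S k (fun w => ln (siegel_defect w)).
Proof. by apply: (Ck_ln oS) => [w /siegelE//|]; exact: (Ck_siegel_defect _ oS). Qed.

Lemma cderive_ln_defect v w : S w ->
  cderive v (fun z => (ln (siegel_defect z))%:C) w = (cdefect w)^-1 * cderive v (@cdefect R n) w.
Proof.
move=> Sw; have d0 : 0 < siegel_defect w by apply/siegelE.
have [dd _] := Ck_siegel_defect 1 oS.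
have [_ E] := derive_ln v d0 (dd w Sw).
have -> : cderive v (@cdefect R n) w = ('D_v (@siegel_defect R n) w)%:C.
  rewrite -(@cderive_eq _ _ _ oS (fun z => (siegel_defect z)%:C) _ v w _ Sw).
    by apply/eqP; rewrite eq_complex /= derive_cst !eqxx.
  by move=> z _; exact: cdefectE.
rewrite -cdefectE -fmorphV -rmorphM /= -E.
by apply/eqP; rewrite eq_complex /= derive_cst !eqxx.
Qed.

Lemma vderive_ln_defect z w : S w ->
  vderive z (fun x => (ln (siegel_defect x))%:C) w = (cdefect w)^-1 * vderive z (@cdefect R n) w.
Proof.
move=> Sw; rewrite /vderive mulr_sumr; apply: eq_bigr => i _.
by rewrite cderive_ln_defect// mulrCA.
Qed.

Lemma dw_ln_defect i w : S w ->
  dw i (fun z => (ln (siegel_defect z))%:C) w = (cdefect w)^-1 * defect10 w i.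
Proof. by move=> Sw; rewrite dw_vderive vderive_ln_defect// -dw_vderive dw_cdefect. Qed.

Lemma dwbar_ln_defect j w : S w ->
  dwbar j (fun z => (ln (siegel_defect z))%:C) w = (cdefect w)^-1 * dwbar j (@cdefect R n) w.
Proof. by move=> Sw; rewrite dwbar_vderive vderive_ln_defect// -dwbar_vderive. Qed.

Lemma CCk_cdefectV k : CCk S k (fun w => (cdefect w)^-1).
Proof.
have d0 w : S w -> siegel_defect w != 0 by move/siegelE/lt0r_neq0.
apply: (CCk_eq oS _ (CCk_real (CkV oS d0 (Ck_siegel_defect k oS)))) => w _.
by rewrite -cdefectE fmorphV.
Qed.

(** Obtained by applying the product rule to D * D^-1 = 1 on the domain. *)
Lemma vderiveV z w : S w -> vderive z (fun w => (cdefect w)^-1) w =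
  - (cdefect w)^-2 * vderive z (@cdefect R n) w.
Proof.
move=> Sw; have D0 := cdefect_neq0 Sw.
have := vderiveM z (CCk_cdefect 1 oS) (CCk_cdefectV 1) Sw.
have -> : vderive z (fun x => cdefect x * (cdefect x)^-1) w = 0.
  rewrite -(vderive_cst z 1 w); apply: (vderive_eq oS) => // x Sx.
  by rewrite mulfV// cdefect_neq0.
move=> /esym/eqP; rewrite addrC addr_eq0 => /eqP E.
by apply: (mulfI D0); rewrite E; field.
Qed.

Lemma ddbar_ln_defect w : S w -> ddbar (fun z => ln (siegel_defect z)) w =
  \matrix_(i, j) (defect11 i j / cdefect w - defect10 w i * defect01 w j / cdefect w ^+ 2).
Proof.
move=> Sw; apply/matrixP => i j; rewrite !mxE; have D0 := cdefect_neq0 Sw.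
rewrite dw_vderive (@vderive_eq _ _ _ oS _ _ (fun z => (cdefect z)^-1 * dwbar j (@cdefect R n) z) w _ Sw).
  have CD : CCk S 1 (dwbar j (@cdefect R n)).
    apply: (CCk_eq oS _ (CCk_vderive oS (antihol (fun l => (l == j)%:R)) (CCk_cdefect 2 oS))).
    by move=> z _; rewrite dwbar_vderive.
  rewrite (vderiveM _ (CCk_cdefectV 1) CD Sw) vderiveV// -!dw_vderive.
  rewrite dw_dwbar_cdefect// dw_cdefect// dwbar_cdefect//.
  by field.
by move=> z Sz; exact: dwbar_ln_defect.
Qed.


Definition inverse_metric w : 'M[C]_n.+1 := \matrix_(i, j)
  (cdefect w / N *
   (if i == top then
      if j == top then 4%:R * (cdefect w + \sum_k coord w (W k) * (coord w (W k))^*%C)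
      else 2%:R * coord w j
    else if j == top then 2%:R * (coord w i)^*%C else (i == j)%:R)).

Lemma omega_siegelE w i j : S w -> omega_siegel R n w i j =
  N * (defect10 w i * defect01 w j / cdefect w ^+ 2 - defect11 i j / cdefect w).
Proof.
by move=> Sw; rewrite /omega_siegel ddbar_ln_defect// !mxE; ring.
Qed.

Let N0 : N != 0. Proof. by rewrite pnatr_eq0. Qed.

Lemma omega_siegel_mulV w : S w -> omega_siegel R n w *m inverse_metric w = 1%:M.
Proof.
move=> Sw; have D0 := cdefect_neq0 Sw.
have M0 := N0.
apply: (@siegel_mulV _ _ (cdefect w) N (fun k => coord w (W k))
  (fun k => (coord w (W k))^*%C) D0 M0).
- move=> k l; rewrite omega_siegelE// /defect10 /defect01 /defect11 !widen_eq_max widen_eq andbT.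
  by ring.
- move=> k; rewrite omega_siegelE// /defect10 /defect01 /defect11 !widen_eq_max eqxx andFb mulr0n.
  by move: (N) => M; field.
- move=> k; rewrite omega_siegelE// /defect10 /defect01 /defect11 !widen_eq_max !max_eq_widen eqxx andFb mulr0n.
  by move: (N) => M; field.
- rewrite omega_siegelE// /defect10 /defect01 /defect11 eqxx /= mulr0n.
  by move: (N) => M; field.
- by move=> k l; rewrite mxE !widen_eq_max widen_eq.
- by move=> k; rewrite mxE widen_eq_max eqxx.
- by move=> k; rewrite mxE widen_eq_max eqxx.
- by rewrite mxE eqxx.
Qed.

Lemma inv_metric_siegel w : S w ->
  inv_metric (omega_siegel R n w) = (inverse_metric w)^T.
Proof.
move=> Sw; have E := omega_siegel_mulV Sw; have [gu _] := mulmx1_unit E.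
by rewrite /inv_metric -[invmx _]mulmx1 -E mulKmx.
Qed.

Lemma sqnorm_siegel (eta : Cvec R n.+1 -> R) w : S w ->
  let f i := dw i (fun z => (eta z)%:C) w in
  let g j := dwbar j (fun z => (eta z)%:C) w in
  sqnorm_d (omega_siegel R n) eta w =
  cdefect w / N *
  (\sum_k (f (W k) + 2%:R * (coord w (W k))^*%C * f top)
          * (g (W k) + 2%:R * coord w (W k) * g top)
   + 4%:R * (cdefect w * (f top * g top))).
Proof.
move=> Sw f g; rewrite /sqnorm_d inv_metric_siegel//.
under eq_bigr do under eq_bigr do rewrite mxE.
apply: (@siegel_form _ _ (cdefect w) N (fun k => coord w (W k))
  (fun k => (coord w (W k))^*%C) _ _ _ _ _ f g).
- by move=> k l; rewrite mxE !widen_eq_max widen_eq.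
- by move=> k; rewrite mxE widen_eq_max eqxx.
- by move=> k; rewrite mxE widen_eq_max eqxx.
- by rewrite mxE eqxx.
Qed.

End Metric.

Lemma dwbar_real (R : realType) (m : nat) (U : set (Cvec R m)) (f : Cvec R m -> R) j w :
  open U -> Ck U 1 f -> U w ->
  dwbar j (fun z => (f z)%:C) w = (dw j (fun z => (f z)%:C) w)^*%C.
Proof.
move=> oU Cf Uw; have CF : CCk U 1 (fun z => (f z)%:C) by exact: CCk_real.
rewrite dwbar_vderive dw_vderive.
have e : (fun l => (l == j)%:R : R[i]) = (fun l : 'I_m => ((l == j)%:R : R[i])^*%C).
  by apply/funext => l; rewrite conjc_nat.
rewrite [in RHS]e -(vderive_conj_antihol oU _ CF Uw).
apply: (vderive_eq oU) => // z _; by rewrite conjc_real.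
Qed.

(** * From the potential to holomorphic data *)

Section Potential.
Variables (R : realType) (n : nat) (eta : Cvec R n.+1 -> R) (c : R).
Local Notation C := R[i].
Local Notation S := (siegel R n).
Local Notation W := (widen_ord (leqnSn n)).
Local Notation top := (@ord_max n).
Local Notation N := ((n.+2)%:R : C).
Hypothesis eta_C3 : Ck S 3 eta.
Hypothesis eta_potential : kahler_potential_on S (omega_siegel R n) eta.
Hypothesis eta_norm : forall w, S w -> sqnorm_d (omega_siegel R n) eta w = c%:C.

Let oS : open S := @open_siegel R n.

Definition pluriharmonic_part (w : Cvec R n.+1) : R :=
  eta w + (n.+2)%:R * ln (siegel_defect w).
Local Notation u := pluriharmonic_part.
Local Notation uC := (fun z => (u z)%:C).
Local Notation etaC := (fun z => (eta z)%:C).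
Local Notation lnC := (fun z => (ln (siegel_defect z))%:C).
Local Notation h := (fun l : 'I_n.+1 => dw l uC).

Lemma Ck_pluriharmonic : Ck S 3 u.
Proof.
exact: (CkD oS eta_C3 (CkM oS (Ck_cst S 3 _) (Ck_ln_defect R n 3))).
Qed.

Let Cu : CCk S 3 uC := CCk_real Ck_pluriharmonic.

Let Ceta : CCk S 3 etaC := CCk_real eta_C3.

Let Cln k : CCk S k lnC := CCk_real (Ck_ln_defect R n k).

Lemma vderive_pluriharmonic z w : S w ->
  vderive z uC w = vderive z etaC w + N * vderive z lnC w.
Proof.
move=> Sw; have C1 := CCkS (CCkS Ceta).
have CN := CCk_cst S 1 N.
(* A zero term, written as the derivative of the constant N times the logarithm, is inserted so that
   the product rule can be read backwards. *)
rewrite -[N * _]add0r -[X in X + N * _](mul0r (lnC w)) -(vderive_cst z N w).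
rewrite -(vderiveM z CN (Cln 1) Sw) -(vderiveD z C1 (CCkM oS CN (Cln 1)) Sw).
apply: (vderive_eq oS) => // x _.
by rewrite /pluriharmonic_part rmorphD rmorphM rmorph_nat.
Qed.

Lemma dwE l F : dw l F = vderive (hol (fun j : 'I_n.+1 => (j == l)%:R)) F :> (Cvec R n.+1 -> C).
Proof. by apply/funext => w; rewrite dw_vderive. Qed.

Lemma dwbarE l F : dwbar l F = vderive (antihol (fun j : 'I_n.+1 => (j == l)%:R)) F :> (Cvec R n.+1 -> C).
Proof. by apply/funext => w; rewrite dwbar_vderive. Qed.

Lemma dw_dwbar_pluriharmonic l m w : S w -> dw l (dwbar m uC) w = 0.
Proof.
move=> Sw.
have CB F : CCk S 3 F -> CCk S 1 (dwbar m F).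
  by move=> CF; rewrite dwbarE; apply: (CCk_vderive oS); exact: CCkS.
have CN := CCk_cst S 1 N.
have E1 : dw l (dwbar m etaC) w = - N * dw l (dwbar m lnC) w.
  have /matrixP/(_ l m) := eta_potential Sw.
  by rewrite /omega_siegel !mxE.
have E2 : dw l (dwbar m uC) w = dw l (fun x => dwbar m etaC x + N * dwbar m lnC x) w.
  rewrite !dw_vderive; apply: (vderive_eq oS) => // x Sx.
  by rewrite !dwbar_vderive vderive_pluriharmonic.
rewrite E2 dw_vderive (vderiveD _ (CB _ Ceta) (CCkM oS CN (CB _ (Cln 3))) Sw).
rewrite (vderiveM _ CN (CB _ (Cln 3)) Sw) vderive_cst mul0r add0r -!dw_vderive E1.
by rewrite mulNr addNr.
Qed.

(** The (0,1)-derivatives of du/dw_l are, after exchanging the two derivations, the coefficients of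
    d dbar u, which vanish. *)
Lemma holo_dw_pluriharmonic l : holo S (h l).
Proof.
split=> [|m w Sw]; first by rewrite dwE; exact: (CCk_vderive oS).
rewrite dwbar_vderive dwE (vderive_comm oS _ _ (CCkS Cu) Sw).
by rewrite -dwbarE -dw_vderive dw_dwbar_pluriharmonic.
Qed.

(** Substituting d eta = h - N dD / D leaves the combinations h_k + 2 conj(w_k) h_n unchanged, since
    the corresponding fields annihilate D. Only the w_n-term changes: it produces -2 N (h_n + conj
    h_n) and, after multiplication by D, the constant N^2. *)
Lemma reduced_norm_potential w : S w -> reduced_norm h N w = N * (c%:C - N).
Proof.
move=> Sw; have D0 := cdefect_neq0 Sw.
have N0 : N != 0 by rewrite pnatr_eq0.
have fE i : dw i etaC w = h i w - N * ((cdefect w)^-1 * defect10 w i).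
  by rewrite -dw_ln_defect// !dw_vderive vderive_pluriharmonic// addrK.
have gE j : dwbar j etaC w = (h j w)^*%C - N * ((cdefect w)^-1 * defect01 w j).
  rewrite -(dwbar_real j oS (CkS (CkS Ck_pluriharmonic)) Sw).
  by rewrite -dwbar_cdefect// -dwbar_ln_defect// !dwbar_vderive vderive_pluriharmonic// addrK.
rewrite -(eta_norm Sw) sqnorm_siegel// /reduced_norm.
rewrite [in RHS](eq_bigr (fun k => (h (W k) w + 2%:R * (coord w (W k))^*%C * h top w)
          * ((h (W k) w)^*%C + 2%:R * coord w (W k) * (h top w)^*%C))); last first.
  move=> k _; rewrite !fE !gE /defect10 /defect01 !widen_eq_max !eqxx.
  by move: (N) (h (W k) w) (h top w) => M a b; field.
rewrite !fE !gE /defect10 /defect01 !eqxx.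
set s := \sum_k _; move: s N0 => s; move: (N) (h top w) => M b M0.
by field; rewrite D0 M0.
Qed.

Lemma gradient_length_eq : c = (n.+2)%:R.
Proof.
have Np : 0 < N by rewrite ltr0n.
have sym j l : dw j (h l) (ex R top) = dw l (h j) (ex R top).
  exact: (dw_comm oS _ _ (CCkS Cu) (siegel_p R n)).
have Kr : (N * (c%:C - N))^*%C = N * (c%:C - N).
  by rewrite rmorphM rmorphB rmorph_nat; congr (_ * (_ - _)); exact: conjc_real.
have /eqP := reduced_norm_eq0 holo_dw_pluriharmonic sym reduced_norm_potential Np Kr.
rewrite mulf_eq0 pnatr_eq0 /= subr_eq0 => /eqP E.
by apply: complexI; rewrite E rmorph_nat.
Qed.

End Potential.

Unset Implicit Arguments.

(* The complex dimension is n.+1. *)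
Theorem theorem3p3 (R : realType) (n : nat) (hn : (2 <= n.+1)%N)
    (psi : Cvec R n.+1 -> R) (c : R)
    (psi_gt0 : forall w, siegel R n w -> 0 < psi w)
    (psi_smooth : smooth_on (siegel R n) psi)
    (psi_potential : kahler_potential_on (siegel R n) (omega_siegel R n)
                       (fun w => ln (psi w)))
    (psi_norm : forall w, siegel R n w ->
       sqnorm_d (omega_siegel R n) (fun z => ln (psi z)) w = c%:C) :
  c = (n.+1)%:R + 1.
Proof.
(* Order 3 is used because the h_l are first derivatives of u and must themselves have order 2. *)
have eta_C3 : Ck (siegel R n) 3 (fun w => ln (psi w)).
  exact: (Ck_ln (@open_siegel R n) psi_gt0 (smooth_on_Ck 3 psi_smooth)).
by rewrite natr1 (gradient_length_eq eta_C3 psi_potential psi_norm).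
Qed.
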